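(* Let $\sigma\subset\mathbb{C}$ be nonempty and compact, let $X$ be a complex Banach space and let $T\in B(X)$ be an $AC(\sigma)$ operator. Then $T=R+iS$ where $R,S\in B(X)$ are commuting well-bounded operators. Further, $\sigma(R)=\operatorname{Re}(\sigma(T))$ and $\sigma(S)=\operatorname{Im}(\sigma(T))$.
   Context: Let $\sigma\subset\mathbb{C}\cong\mathbb{R}^2$ be nonempty and compact. Let $\Gamma=C([0,1],\mathbb{C})$ be the set of curves. For $\gamma\in\Gamma$ and $f:\sigma\to\mathbb{C}$ put $\operatorname{cvar}(f,\gamma)=\sup\sum_{i=1}^{n-1}|f(s_{i+1})-f(s_i)|$, the supremum over finite sequences $s_i=\gamma(t_i)\in\sigma$ with $0\le t_1\le\dots\le t_n\le 1$. For a line $l$, $\operatorname{vf}(\gamma,l)$ is the number of times $\gamma$ crosses $l$, i.e. the number of entry points: $t\in[0,1]$ with $\gamma(t)\in l$ and either $t=0$ or for every $\epsilon>0$ there is $s\in(t-\epsilon,t)\cap[0,1]$ with $\gamma(s)\notin l$. Put $\operatorname{vf}(\gamma)=\sup_l\operatorname{vf}(\gamma,l)$, $\rho(\gamma)=1/\operatorname{vf}(\gamma)$ (with $\rho(\gamma)=0$ if $\operatorname{vf}(\gamma)=\infty$), $\operatorname{var}(f,\sigma)=\sup_{\gamma\in\Gamma}\rho(\gamma)\operatorname{cvar}(f,\gamma)$, and $\|f\|_{BV(\sigma)}=\|f\|_\infty+\operatorname{var}(f,\sigma)$. $BV(\sigma)$ is the Banach algebra of all $f:\sigma\to\mathbb{C}$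 with $\|f\|_{BV(\sigma)}<\infty$, and $AC(\sigma)$ is the closed subalgebra of $BV(\sigma)$ generated by $1$, $\boldsymbol{\lambda}$ and $\overline{\boldsymbol{\lambda}}$, where $\boldsymbol{\lambda}(z)=z$, with the $BV(\sigma)$ norm. For $\sigma=[a,b]$ these are the usual spaces of functions of bounded variation and absolutely continuous functions. $T\in B(X)$ is an $AC(\sigma)$ operator if there is a bounded unital algebra homomorphism $\psi:AC(\sigma)\to B(X)$ with $\psi(\boldsymbol{\lambda})=T$. $T$ is well-bounded if it is an $AC(J)$ operator for some compact interval $J\subset\mathbb{R}$. $\sigma(T)$ denotes the spectrum of $T$. *)

(* Defs.v *)
From HB Require Import structures.
From mathcomp Require Import all_boot all_order all_algebra complex.
From mathcomp Require Import all_classical all_reals all_analysis.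
Set Implicit Arguments.
Unset Strict Implicit.
Unset Printing Implicit Defensive.
Import Order.TTheory GRing.Theory Num.Theory.
Import numFieldNormedType.Exports.
Local Open Scope classical_set_scope.
Local Open Scope complex_scope.
Local Open Scope ring_scope.

(* R[i] receives the topology of its modulus, through its regular module. *)
HB.instance Definition _ (R : realType) := PseudoPointedMetric.copy R[i] R[i]^o.
HB.instance Definition _ (R : realType) := NormedModule.copy R[i] R[i]^o.

(* Norms of normed R[i]-modules are R[i]-valued; this is the same norm in R. *)
Definition rnorm (R : realType) (V : normedModType R[i]) (x : V) : R :=
  complex.Re `|x|.

Section curves.
Variable R : realType.
Implicit Types (gamma : R -> R[i]) (l : set R[i]).

(* A curve is a map on all of R of which only the values on [0, 1] matter. *)
Definition curve : set (R -> R[i]) :=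
  [set gamma : R -> R[i] | {within `[0, 1], continuous gamma}].

Definition line : set (set R[i]) :=
  [set l | exists p v : R[i], v != 0 /\ l = [set p + t%:C * v | t in [set: R]]].

Definition entry_points gamma l : set R :=
  [set t | [/\ 0 <= t <= 1, l (gamma t) &
     t = 0 \/ forall eps : R, 0 < eps ->
       exists s : R, [/\ t - eps < s < t, 0 <= s <= 1 & ~ l (gamma s)]]].

Definition vf gamma : \bar R :=
  ereal_sup [set counting (entry_points gamma l) | l in line].

(* In \bar R, the inverse of +oo is 0. *)
Definition rho gamma : \bar R := ((vf gamma)^-1)%E.

End curves.

Section function_spaces.
Variables (R : realType) (sigma : set R[i]).
Implicit Types (f g : sigma -> R[i]) (gamma : R -> R[i]).

(* The points are s_0, ..., s_(n-1); n = 0 is allowed, so that the variation  *)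
(* along a curve missing sigma is 0.                                          *)
Definition cvar f gamma : \bar R :=
  ereal_sup [set v | exists (n : nat) (t : nat -> R) (s : nat -> sigma),
    [/\ forall i, (i < n)%N -> 0 <= t i <= 1,
        forall i j, (i <= j)%N -> (j < n)%N -> t i <= t j,
        forall i, (i < n)%N -> val (s i) = gamma (t i) &
        v = (\sum_(i < n.-1) rnorm (f (s i.+1) - f (s i)))%:E]].

(* In \bar R, 0 * +oo = 0: a curve with vf gamma = +oo never contributes. *)
Definition var f : \bar R :=
  ereal_sup [set (rho gamma * cvar f gamma)%E | gamma in @curve R].

Definition sup_norm f : \bar R := ereal_sup [set (rnorm (f z))%:E | z in setT].

Definition BV_norm f : \bar R := (sup_norm f + var f)%E.

Definition BV : set (sigma -> R[i]) := [set f | (BV_norm f < +oo)%E].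

Definition lambda : sigma -> R[i] := fun z => val z.
Definition lambda_bar : sigma -> R[i] := fun z => (val z)^*.

Definition closed_subalgebra : set (set (sigma -> R[i])) :=
  [set A | A `<=` BV /\
    [/\ forall f g, A f -> A g -> A (f + g),
        forall (a : R[i]) f, A f -> A (a *: f),
        forall f g, A f -> A g -> A (f * g) &
        forall f, BV f ->
          (forall eps : R, 0 < eps ->
             exists2 g, A g & (BV_norm (f - g)%R < eps%:E)%E) ->
          A f]].

Definition AC : set (sigma -> R[i]) :=
  smallest closed_subalgebra [set 1; lambda; lambda_bar].

End function_spaces.

Section operators.
Variables (R : realType) (X : completeNormedModType R[i]).
Implicit Types T : {linear X -> X}.

Definition opnorm T : \bar R :=
  ereal_sup [set (rnorm (T x))%:E | x in [set x : X | rnorm x <= 1]].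

Definition bounded_op T : Prop := (opnorm T < +oo)%E.

(* psi is total, but only its values on AC sigma are constrained. *)
Definition AC_functional_calculus (sigma : set R[i])
    (psi : (sigma -> R[i]) -> {linear X -> X}) : Prop :=
  (forall f, AC f -> bounded_op (psi f)) /\
  [/\ forall f g, AC f -> AC g -> forall x, psi (f + g) x = psi f x + psi g x,
      forall (a : R[i]) f, AC f -> forall x, psi (a *: f) x = a *: psi f x,
      forall f g, AC f -> AC g -> forall x, psi (f * g) x = psi f (psi g x),
      forall x, psi 1 x = x &
      exists M : R, forall f, AC f -> (opnorm (psi f) <= M%:E * BV_norm f)%E].

Definition AC_operator (sigma : set R[i]) T : Prop :=
  exists2 psi : (sigma -> R[i]) -> {linear X -> X},
    AC_functional_calculus psi & forall x, psi (@lambda R sigma) x = T x.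

Definition well_bounded T : Prop :=
  exists a b : R, a <= b /\ AC_operator [set x%:C | x in `[a, b]] T.

Definition spectrum T : set R[i] :=
  [set z | ~ exists U : {linear X -> X},
    [/\ bounded_op U, forall x, U (z *: x - T x) = x &
        forall x, z *: U x - T (U x) = x]].

End operators.

(* Main.v *)
Require Import Defs.
From HB Require Import structures.
From mathcomp Require Import all_boot all_order all_algebra complex.
From mathcomp Require Import all_classical all_reals all_analysis.
From mathcomp Require Import measurable_realfun.
From mathcomp Require Import ring lra.
Import Defs.
Import Order.TTheory GRing.Theory Num.Theory.
Import numFieldNormedType.Exports.
Local Open Scope classical_set_scope.
Local Open Scope complex_scope.
Local Open Scope ring_scope.

(** Let psi be the functional calculus of T. The natural candidates are
    A = psi(Re z) and B = psi(Im z); they commute and A + iB = psi(z) = T. To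
    treat both at once, fix a unimodular c, put zeta(z) = c z and study
    psi(Re zeta): c = 1 gives A, c = -i gives B.

    Well-boundedness. The calculus of psi(Re zeta) on an interval is
    f |-> psi(f o Re zeta). It makes sense because composing with Re zeta does
    not increase the BV norm ([BV_norm_comp]): if gamma is a curve in the plane,
    its projection on the real line crosses a line no more often than gamma
    crosses the corresponding vertical line ([vf_real_part]), so the weight rho
    can only increase. Functions which a closed subalgebra reaches after
    composition form a closed subalgebra again, hence AC goes to AC ([AC_comp]).

    Lipschitz functions. On a bounded sigma a Lipschitz function lies in BV, with
    norm at most (sup norm) + const * (Lipschitz constant)
    ([bounded_lipschitz_BV_norm]). It suffices to see this for the two
    coordinates, and there it is a counting argument: each level is crossed at
    most vf(gamma) times, and integrating the number of crossings over the levels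
    bounds the variation. As a consequence the geometric series shows that AC is
    stable under inversion of functions bounded away from zero ([AC_inv],
    [AC_inv_complex]), so all rational functions used below are in AC, and their
    images under psi are bounded in terms of sup norms and Lipschitz constants.

    Spectra. Bumps can be taken rational: with t = w - zeta, the function
    k = d^2 / (|t|^2 + d^2) is concentrated near the point w, and t k = d g where
    g = d t / (|t|^2 + d^2) is bounded by 1 and 1/d-Lipschitz. So
    t^m k^m = d^m g^m is small of order d^(m-1) in Lipschitz norm.
    - psi(Re zeta) has real spectrum, since 1 / (a - Re zeta) is in AC for a not
      real ([resolvent_nonreal]).
    - If r is outside the spectrum of psi(Re zeta), let u = r - Re zeta and w be
      any point with real part r. Then t divides u^2 (1 - k^2), while u^2 k^2 is
      small; as psi(u) is invertible, w - psi(zeta) has approximate inverses,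
      hence is invertible ([resolvent_line]).
    - If the whole vertical line Re w = r is outside the spectrum of psi(zeta),
      then |x| <= a |(w - psi(zeta)) x| with the same a for all relevant w on the
      line ([uniform_lower_bound]). Place bumps k_j^9 at the points of a grid of
      mesh d = 1/n on the line and let S be their sum. From
      psi(t_j)^9 psi(k_j^9) = d^9 psi(g_j^9) one gets |psi(S)| = O(d^7). On the
      other hand F = u^2 + S >= const * d^2, so |psi(1/F)| = O(d^(-6)). Therefore
      psi(u/F) psi(u) = 1 - psi(1/F) psi(S) is within O(d) of the identity, and
      r - psi(Re zeta) = psi(u) is invertible ([resolvent_projection]). *)

Set Implicit Arguments.
Unset Strict Implicit.
Unset Printing Implicit Defensive.

(** * Real-valued norms over the complex numbers *)

Section real_norm.
Variable R : realType.

Section normed_module.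
Variable V : normedModType R[i].
Implicit Types x y : V.

Lemma rnormE x : `|x| = (rnorm x)%:C.
Proof.
have := normr_ge0 x; rewrite lecE /= => /andP[/eqP im0 _].
by rewrite /rnorm; case: `|x| im0 => a b /= ->.
Qed.

Lemma rnorm_ge0 x : 0 <= rnorm x.
Proof. by have := normr_ge0 x; rewrite lecE => /andP[_]. Qed.

Lemma ler_rnormD x y : rnorm (x + y) <= rnorm x + rnorm y.
Proof. by have := ler_normD x y; rewrite !rnormE -rmorphD /= lecR. Qed.

Lemma rnormN x : rnorm (- x) = rnorm x.
Proof. by rewrite /rnorm normrN. Qed.

Lemma rnormB x y : rnorm (x - y) = rnorm (y - x).
Proof. by rewrite -rnormN opprB. Qed.

Lemma rnorm0 : rnorm (0 : V) = 0.
Proof. by rewrite /rnorm normr0. Qed.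

Lemma rnorm_eq0 x : rnorm x = 0 -> x = 0.
Proof. by move=> x0; apply/normr0_eq0; rewrite rnormE x0. Qed.

Lemma rnorm_sum (I : Type) (s : seq I) (F : I -> V) :
  rnorm (\sum_(i <- s) F i) <= \sum_(i <- s) rnorm (F i).
Proof.
elim/big_ind2 : _ => [|x a y b xa yb|//]; first by rewrite rnorm0.
exact: le_trans (ler_rnormD _ _) (lerD xa yb).
Qed.

End normed_module.

Implicit Types z w : R[i].

Lemma rnorm_def z :
  rnorm z = Num.sqrt (complex.Re z ^+ 2 + complex.Im z ^+ 2).
Proof. by case: z. Qed.

Lemma Re_mul z w :
  complex.Re (z * w) = complex.Re z * complex.Re w - complex.Im z * complex.Im w.
Proof. by case: z w => [? ?] [? ?]. Qed.

Lemma rnormZ (V : normedModType R[i]) z (x : V) :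
  rnorm (z *: x) = rnorm z * rnorm x.
Proof.
have -> : rnorm z = complex.Re `|z| by [].
rewrite /rnorm normrZ; have := normr_ge0 x; rewrite lecE => /andP[/eqP im0 _].
by rewrite Re_mul im0 mulr0 subr0.
Qed.

Lemma rnormM z w : rnorm (z * w) = rnorm z * rnorm w.
Proof. exact: rnormZ. Qed.

Lemma rnorm_sqr z : rnorm z ^+ 2 = complex.Re z ^+ 2 + complex.Im z ^+ 2.
Proof.
by rewrite rnorm_def sqr_sqrtr // addr_ge0 // sqr_ge0.
Qed.

Lemma rnormr (a : R) : rnorm a%:C = `|a|.
Proof.
by rewrite rnorm_def /= expr0n addr0 sqrtr_sqr.
Qed.

Lemma rnormJ z : rnorm z^* = rnorm z.
Proof. by rewrite !rnorm_def; case: z => a b /=; rewrite sqrrN. Qed.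

Lemma mulrJ z : z * z^* = (rnorm z ^+ 2)%:C.
Proof.
rewrite rnorm_sqr; case: z => a b; apply/eqP; rewrite eq_complex /=.
by apply/andP; split; apply/eqP; ring.
Qed.

Lemma Re_le_rnorm z : `|complex.Re z| <= rnorm z.
Proof.
rewrite -ler_sqr ?nnegrE ?normr_ge0 ?rnorm_ge0 //.
by rewrite rnorm_sqr real_normK ?num_real // lerDl sqr_ge0.
Qed.

Lemma Im_le_rnorm z : `|complex.Im z| <= rnorm z.
Proof.
rewrite -ler_sqr ?nnegrE ?normr_ge0 ?rnorm_ge0 //.
by rewrite rnorm_sqr real_normK ?num_real // lerDr sqr_ge0.
Qed.

Lemma rnorm_i : rnorm ('i%C : R[i]) = 1.
Proof. by rewrite rnorm_def /= expr0n expr1n add0r sqrtr1. Qed.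

Lemma rnorm_le_ReIm z : rnorm z <= `|complex.Re z| + `|complex.Im z|.
Proof.
rewrite [z in X in X <= _]complexE; apply: le_trans (ler_rnormD _ _) _.
by rewrite rnormM !rnormr rnorm_i mul1r.
Qed.

(** The topology of R[i] is defined by radii in R[i] and the one of a real module
    by radii in R; this lemma and the next one do the translation once. *)
Lemma lipschitz_within_continuous (A : set R) (gamma : R -> R[i])
    (W : normedModType R) (f : R[i] -> W) (K : R) :
  (forall z w, `|f z - f w| <= K * rnorm (z - w)) ->
  {within A, continuous gamma} -> {within A, continuous (f \o gamma)}.
Proof.
move=> lipf cg x; apply: (cvg_comp _ _ (cg x)).
apply/cvgrPdist_lt => e e0.
have K0 : 0 < `|K| + 1 by rewrite ltr_pwDr.
have : \forall z \near gamma x, `|gamma x - z| < (e / (`|K| + 1))%:C.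
  have /cvgrPdist_lt := (@cvg_id _ (nbhs (gamma x : R[i]^o))).
  by apply; rewrite ltcR divr_gt0.
apply: filterS => z;
  rewrite -[`|_|]/(`|(gamma x - z : R[i]^o)|) rnormE ltcR ltr_pdivlMr // => ze.
apply: le_lt_trans (lipf _ _) _; apply: le_lt_trans ze.
rewrite mulrC ler_wpM2l ?rnorm_ge0 //.
by rewrite (le_trans (ler_norm K)) // lerDl.
Qed.

Lemma lipschitz_within_continuousC (A : set R) (gamma : R -> R[i])
    (f : R[i] -> R[i]) (K : R) :
  (forall z w, rnorm (f z - f w) <= K * rnorm (z - w)) ->
  {within A, continuous gamma} -> {within A, continuous (f \o gamma)}.
Proof.
move=> lipf cg x; apply: (cvg_comp _ _ (cg x)).
apply/(@cvgrPdist_lt _ R[i]^o) => e e0.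
have K0 : 0 < `|K| + 1 by rewrite ltr_pwDr.
have : \forall z \near gamma x, `|gamma x - z| < ((complex.Re e) / (`|K| + 1))%:C.
  have /cvgrPdist_lt := (@cvg_id _ (nbhs (gamma x : R[i]^o))).
  apply; rewrite ltcR divr_gt0 //.
  by move: e0; rewrite ltcE => /andP[].
apply: filterS => z;
  rewrite -[`|_|]/(`|(gamma x - z : R[i]^o)|) rnormE ltcR ltr_pdivlMr // => ze.
rewrite rnormE ltcE /=; apply/andP; split.
  by move: e0; rewrite ltcE /= => /andP[].
apply: le_lt_trans (lipf _ _) _; apply: le_lt_trans ze.
rewrite mulrC ler_wpM2l ?rnorm_ge0 //.
by rewrite (le_trans (ler_norm K)) // lerDl.
Qed.

(** The norm of R[i] takes its values in R[i]; a real bound is read off from the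
    covering property, with the bound itself as the filtered parameter. *)
Lemma compact_rnorm_bounded (A : set R[i]) : compact A ->
  exists2 K : R, 0 <= K & forall z, A z -> rnorm z <= K.
Proof.
move=> /compact_near_coveringP cA.
have [|K [_ KP]] := cA R +oo%R (fun K z => rnorm z <= K) _.
  move=> x Ax; exists ([set z | `|x - z| < 1], [set K | rnorm x + 1 < K]).
    split => /=; last first.
      by exists (rnorm x + 1); split; [exact: num_real|].
    have /cvgrPdist_lt := (@cvg_id _ (nbhs (x : R[i]^o))).
    by apply; rewrite ltr01.
  move=> [z K] /= [+ /ltW xK].
  rewrite -[`|_|]/(`|(x - z : R[i]^o)|) rnormE ltcR => xz1.
  apply: le_trans xK; rewrite -[z](subKr x) (le_trans (ler_rnormD _ _)) //.
  by rewrite lerD2l rnormN ltW.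
exists (`|K| + 1); first by rewrite addr_ge0.
by apply: KP; rewrite (le_lt_trans (ler_norm K)) // ltrDl.
Qed.

End real_norm.

(** * Crossings of a curve with vertical lines *)

Section counting.
Variables (R : realType) (T : choiceType).
Implicit Types (A B : set T) (s : seq T).

(** The only way in which lower bounds for vf are produced: exhibit distinct entry
    points. *)
Lemma counting_ge_size A s : uniq s -> (forall x, x \in s -> A x) ->
  ((size s)%:R%:E <= counting A :> \bar R)%E.
Proof.
move=> us sA; rewrite /counting; case: asboolP => [finA|_]; last exact: leey.
rewrite lee_fin ler_nat; apply: uniq_leq_size => // x /sA Ax.
by rewrite in_fset_set // inE.
Qed.

Lemma counting_le1 A x : A `<=` [set x] -> (counting A <= 1%:E :> \bar R)%E.
Proof.
move=> /[dup] sA /sub_finite_set /(_ (finite_set1 x)) finA.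
rewrite /counting asboolT // lee_fin (ler_nat _ _ 1%N).
have -> : 1%N = size [:: x] by [].
apply: uniq_leq_size => [|y]; first exact: finmap.fset_uniq.
by rewrite in_fset_set // !inE => /sA ->.
Qed.

End counting.

Section curves.
Variable R : realType.
Implicit Types (gamma : R -> R[i]) (c : R[i]).

(** The line on which Re(c z) = x; for |c| = 1 it is perpendicular to the
    direction conj(c). *)
Definition level c (x : R) : set R[i] := [set z | complex.Re (c * z) = x].

Lemma line_level c x : rnorm c = 1 -> line (level c x).
Proof.
move=> c1; exists (c^* * x%:C), ('i%C * c^*); split.
  apply/eqP => /(congr1 (@rnorm _ _)) /eqP.
  by rewrite rnormM rnorm_i rnormJ c1 mul1r rnorm0 oner_eq0.
have /eqP : rnorm c ^+ 2 = 1 by rewrite c1 expr1n.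
rewrite rnorm_sqr => /eqP; case: c {c1} => a b /= ab1.
apply/seteqP; split => [[p q]|_ [t _ <-]] /=; rewrite /level /=.
  move=> pq; exists (a * q + b * p) => //; rewrite -pq.
  apply/eqP; rewrite eq_complex /=; apply/andP; split; apply/eqP.
    by rewrite -[RHS]mul1r -[X in _ = X * _]ab1; ring.
  by rewrite -[RHS]mul1r -[X in _ = X * _]ab1; ring.
by rewrite -[RHS]mul1r -[X in _ = X * _]ab1; ring.
Qed.

Lemma vf_ge_counting gamma c x : rnorm c = 1 ->
  (counting (entry_points gamma (level c x)) <= vf gamma)%E.
Proof.
by move=> c1; apply: ereal_sup_ubound; exists (level c x) => //; exact: line_level.
Qed.

Lemma vf_ge1 gamma : (1%:E <= vf gamma)%E.
Proof.
have c1 : rnorm (1 : R[i]) = 1 by rewrite (rnormr 1) normr1.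
apply: le_trans (vf_ge_counting gamma (complex.Re (1 * gamma 0)) c1).
apply: (@counting_ge_size _ _ _ [:: 0]) => // t; rewrite inE => /eqP ->.
by split; [rewrite lexx ler01 | | left].
Qed.

(** Orthogonal projection on the real axis, after the rotation by c. *)
Definition real_part c (z : R[i]) : R[i] := (complex.Re (c * z))%:C.

(** A line through exactly one real point x meets the projected curve when the
    original curve meets the line Re(c z) = x. The real line itself is entered
    at time 0 only, and a line without real points never: both cases are covered
    by vf >= 1. *)
Lemma vf_real_part gamma c : rnorm c = 1 ->
  (vf (real_part c \o gamma) <= vf gamma)%E.
Proof.
move=> c1; apply: ge_ereal_sup => _ [l [p [v [v0 ->]]] <-].
set l' := [set _ | _ in _]; set E := entry_points _ _.
have [[x lx]|l'0] := pselect (exists x : R, l' x%:C); last first.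
  apply: le_trans (vf_ge1 gamma); apply: (@counting_le1 _ _ _ 0).
  by move=> t [_ lt _]; case: l'0; exists (complex.Re (c * gamma t)); exact: lt.
have [all_real|/existsNP[y ly]] := pselect (forall y : R, l' y%:C).
  apply: le_trans (vf_ge1 gamma); apply: (@counting_le1 _ _ _ 0).
  by move=> t [_ _ [->//|/(_ 1 ltr01)[s [_ _ []]]]]; exact: all_real.
suff -> : E = entry_points gamma (level c x) by exact: vf_ge_counting.
have l'E z : l' (real_part c z) <-> level c x z.
  rewrite /level /real_part /=; split=> [lz|->//].
  apply: contrapT => zx; apply: ly.
  case: lx lz => [t1 _ e1] [t2 _ e2].
  set y0 := complex.Re (c * z) in zx e2 *.
  have y0x : y0 - x != 0 by rewrite subr_eq0; exact/eqP.
  exists (t1 + (y - x) / (y0 - x) * (t2 - t1)) => //.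
  have -> : y%:C = x%:C + ((y - x) / (y0 - x))%:C * (y0%:C - x%:C).
    by rewrite -rmorphB -rmorphM -rmorphD; congr (_%:C); field.
  by rewrite -{1}e1 -e1 -e2 rmorphD rmorphM rmorphB /=; ring.
apply/seteqP; split => t [t01 /l'E lt lim]; split => //; case: lim => [|lim].
- by left.
- by right => e /lim[s [? ? ns]]; exists s; split => // /l'E.
- by left.
- by right => e /lim[s [? ? ns]]; exists s; split => // /l'E.
Qed.

Lemma vf_real gamma : (vf gamma < +oo)%E ->
  exists2 N : R, 1 <= N & vf gamma = N%:E.
Proof.
have := vf_ge1 gamma; case: (vf gamma) => [N|//|//] N1 _.
by exists N => //; rewrite -lee_fin.
Qed.

(** Between a point below the level and one above it, the infimum of the times at
    which the level is attained is a time preceded only by other values: this is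
    what makes it an entry point. *)
Lemma first_hit (h : R -> R) (a b x : R) : a <= b ->
  {within `[a, b], continuous h} ->
  (h a < x < h b) || (h b < x < h a) ->
  exists t, [/\ a < t < b, h t = x & forall s, a <= s < t -> h s <> x].
Proof.
move=> ab ch hx.
have hax : h a != x by apply/eqP => e; move: hx; rewrite e ltxx andbF.
have hbx : h b != x by apply/eqP => e; move: hx; rewrite e ltxx andbF.
pose E := [set t | a <= t <= b /\ h t = x].
have E0 : E !=set0.
  have [|t] := IVT (v := x) ab ch.
    by rewrite ge_min le_max; case/orP : hx => /andP[/ltW -> /ltW ->]; rewrite ?orbT.
  by rewrite in_itv /= => tab htx; exists t.
have lbE : has_lbound E by exists a => t [/andP[]].
have hi : has_inf E by split.
have aE : a <= inf E by apply: lb_le_inf => // t [/andP[]].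
have Eb : inf E <= b.
  by have [t [/[dup] tab /andP[_ tb] htx]] := E0; apply: le_trans tb; exact: ge_inf.
have hinf : h (inf E) = x.
  apply: contrapT => /eqP hnx.
  have /subspace_continuousP /(_ (inf E)) := ch.
  rewrite /= in_itv /= aE Eb => /(_ isT) /cvgrPdist_lt /(_ `|h (inf E) - x|).
  rewrite normr_gt0 subr_eq0 hnx => /(_ isT) /nbhs_ballP [d /= d0 dP].
  have [s Es sd] := inf_adherent d0 hi.
  have : `|h (inf E) - h s| < `|h (inf E) - x|.
    apply: dP; last by case: Es; rewrite /= in_itv.
    rewrite /ball /= distrC ger0_norm ?subr_ge0 ?ge_inf //.
    by rewrite ltrBlDl.
  by case: Es => _ ->; rewrite ltxx.
exists (inf E); split => //.
- rewrite !lt_neqAle aE Eb !andbT; apply/andP; split; apply/eqP => e.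
    by move: hax; rewrite e hinf eqxx.
  by move: hbx; rewrite -e hinf eqxx.
- move=> s /andP[as_ sE] hsx; move: (sE); rewrite ltNge => /negP; apply.
  apply: ge_inf => //; split; last by [].
  by rewrite as_ (le_trans (ltW sE)).
Qed.

Definition between (x y c : R) : bool := (x < c < y) || (y < c < x).

(** Each step across the level contains an entry point in the interior of its time
    interval, and these intervals do not overlap. *)
Lemma crossings_le_vf gamma c (n : nat) (t : nat -> R) (N x : R) :
  rnorm c = 1 -> curve gamma -> vf gamma = N%:E ->
  (forall i, (i <= n)%N -> 0 <= t i <= 1) ->
  (forall i j, (i <= j)%N -> (j <= n)%N -> t i <= t j) ->
  (\sum_(i < n) between (complex.Re (c * gamma (t i))%R)
                   (complex.Re (c * gamma (t i.+1))%R) x)%:R <= N.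
Proof.
move=> c1 cg vN t01 tmono; pose h (s : R) := complex.Re (c * gamma s).
have ch : {within `[0, 1], continuous h}.
  apply: (@lipschitz_within_continuous _ _ gamma R^o (fun z => complex.Re (c * z)) 1) => // z w.
  rewrite -raddfB /= -mulrBr (le_trans (Re_le_rnorm _)) // rnormM c1.
  exact: lexx.
have hit i : exists s, (i < n)%N -> between (h (t i)) (h (t i.+1)) x ->
    [/\ t i < s < t i.+1, h s = x & forall r, t i <= r < s -> h r <> x].
  have [/andP[ni b]|nb] := boolP ((i < n)%N && between (h (t i)) (h (t i.+1)) x);
    last first.
    by exists 0 => ni b; rewrite ni b in nb.
  have [||s sP] := @first_hit h (t i) (t i.+1) x _ _ b; last by exists s.
    exact: tmono.
  apply: continuous_subspaceW ch => r /=; rewrite !in_itv /= => /andP[tr rt].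
  have /andP[t0 _] := t01 i (ltnW ni); have /andP[_ t1] := t01 i.+1 ni.
  by rewrite (le_trans t0) //= (le_trans rt).
have [tau tauP] := choice hit.
pose s := [seq i <- iota 0 n | between (h (t i)) (h (t i.+1)) x].
have sP i : i \in s -> (i < n)%N /\ between (h (t i)) (h (t i.+1)) x.
  by rewrite mem_filter mem_iota add0n => /andP[-> /=].
have -> : (\sum_(i < n) between (h (t i)) (h (t i.+1)) x = size (map tau s))%N.
  rewrite size_map size_filter -sum1_count /index_iota.
  rewrite -(big_mkord xpredT (fun i => nat_of_bool (between (h (t i)) (h (t i.+1)) x))).
  by rewrite /index_iota subn0 [RHS]big_mkcond /=; apply: eq_bigr => i _; case: between.
rewrite -lee_fin -vN; apply: le_trans (vf_ge_counting gamma x c1).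
apply: counting_ge_size.
  rewrite map_inj_in_uniq; first by rewrite filter_uniq // iota_uniq.
  move=> i j /sP[ni bi] /sP[nj bj] eij.
  have [/andP[i1 i2] _ _] := tauP i ni bi; have [/andP[j1 j2] _ _] := tauP j nj bj.
  case: (ltngtP i j) => // ij.
    by have := lt_trans (lt_le_trans i2 (tmono _ _ ij (ltnW nj))) j1; rewrite eij ltxx.
  by have := lt_trans (lt_le_trans j2 (tmono _ _ ij (ltnW ni))) i1; rewrite eij ltxx.
move=> _ /mapP[/= i /sP[ni bi] ->].
have [/andP[i1 i2] hx hlt] := tauP i ni bi.
have /andP[t0 _] := t01 i (ltnW ni); have /andP[_ t1] := t01 i.+1 ni.
split => //; first by apply/andP; split; lra.
(* A time strictly before tau i, after t i, and less than eps away. *)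
right => eps e0; exists (Num.max (t i) (tau i - eps / 2)).
have m1 : t i <= Num.max (t i) (tau i - eps / 2) by rewrite le_max lexx.
have m2 : Num.max (t i) (tau i - eps / 2) < tau i.
  by rewrite gt_max i1 ltrBlDr ltrDl divr_gt0.
split.
- by rewrite m2 andbT lt_max; apply/orP; right; lra.
- by apply/andP; split; lra.
- by apply: hlt; rewrite m1.
Qed.

End curves.

(** * Variation as an integral of crossing numbers *)

Section sum_variation.
Variable R : realType.

(** The left-hand side is the integral over the levels c of the number of steps
    which cross c, and this number vanishes outside [a, b]. *)
Lemma sum_variation_le (x : nat -> R) (n : nat) (a b N : R) :
  (forall i, (i <= n)%N -> a <= x i <= b) ->
  (forall c, (\sum_(i < n) between (x i) (x i.+1) c)%:R <= N) ->
  \sum_(i < n) `|x i.+1 - x i| <= N * (b - a).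
Proof.
move=> xab xN.
have ab : a <= b by have /andP[/le_trans] := xab 0%N (leq0n _); apply.
have N0 : 0 <= N by apply: le_trans (xN 0); rewrite ler0n.
pose mu := @lebesgue_measure R.
pose I (i : nat) : set R :=
  [set` `]Num.min (x i) (x i.+1), Num.max (x i) (x i.+1)[].
have IE i c : I i c = between (x i) (x i.+1) c.
  rewrite /I /between /= in_itv /= gt_min lt_max.
  by case: (ltgtP (x i) (x i.+1)) => xx; apply/propext; split; lra.
have muI (i : 'I_n) : (\int[mu]_(c in `[a, b]) (\1_(I i) c)%:E)%E = (`|x i.+1 - x i|)%:E.
  rewrite integral_indic ?setIidl; last 3 first.
    move=> c; rewrite IE /between /= in_itv /=.
    have /andP[? ?] := xab i (ltnW (ltn_ord i));
      have /andP[? ?] := xab i.+1 (ltn_ord i).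
    by case/orP => /andP[? ?]; apply/andP; split; lra.
  - exact: measurable_itv.
  - exact: measurable_itv.
  etransitivity; first exact: lebesgue_measure_itv.
  rewrite /= lte_fin.
  case: (ltgtP (x i) (x i.+1)) => xx; rewrite ?ltxx ?xx ?subrr ?normr0 -?EFinB //.
    by rewrite gtr0_norm // subr_gt0.
  by rewrite ltr0_norm ?opprB // subr_lt0.
rewrite -lee_fin -sumEFin; under eq_bigr do rewrite -muI.
have mI (i : 'I_n) : measurable_fun `[a, b] (fun c : R => (\1_(I i) c : R)%:E).
  by apply/measurable_EFinP; apply: measurable_indic; exact: measurable_itv.
have I0 (i : 'I_n) c : `[a, b]%classic c -> (0 <= (\1_(I i) c)%:E :> \bar R)%E.
  by move=> _; rewrite lee_fin.
rewrite -(ge0_integral_sum mu (measurable_itv _) mI I0).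
apply: (@le_trans _ _ (\int[mu]_(c in `[a, b]) (N)%:E)%E); last first.
  have muab : mu [set` `[a, b]] = (b - a)%:E.
    etransitivity; first exact: lebesgue_measure_itv.
    rewrite /= lte_fin; move: ab; rewrite le_eqVlt => /predU1P[->|->];
      last by rewrite EFinB.
    by rewrite ltxx subrr.
  rewrite integral_cst; last exact: measurable_itv.
  by rewrite [X in (_ * X)%E]muab -EFinM.
apply: ge0_le_integral => //.
- by move=> c _; apply: sume_ge0 => i _; rewrite lee_fin.
- exact: emeasurable_sum.
move=> c _; rewrite sumEFin lee_fin; apply: le_trans (xN c).
rewrite natr_sum; apply: ler_sum => i _.
rewrite indicE; case: (boolP (between _ _ _)) => [_|nb]; first by case: (_ \in _).
by rewrite memNset // IE; exact/negP.
Qed.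

End sum_variation.

(** * Functions of bounded variation *)

Section variation.
Variables (R : realType) (sigma : set R[i]).
Implicit Types (f g : sigma -> R[i]) (gamma : R -> R[i]).

Definition chain gamma (n : nat) (t : nat -> R) (s : nat -> sigma) : Prop :=
  [/\ forall i, (i < n)%N -> 0 <= t i <= 1,
      forall i j, (i <= j)%N -> (j < n)%N -> t i <= t j &
      forall i, (i < n)%N -> val (s i) = gamma (t i)].

(** A bound for the BV norm free of extended reals: only curves with finite vf are
    tested, and the weight 1 / vf is moved to the other side. *)
Definition BV_bound f (b v : R) : Prop :=
  (forall z, rnorm (f z) <= b) /\
  forall gamma N n t s, curve gamma -> vf gamma = N%:E -> chain gamma n t s ->
    \sum_(i < n.-1) rnorm (f (s i.+1) - f (s i)) <= v * N.

Lemma cvar_ge0 f gamma (z : sigma) : (0%:E <= cvar f gamma)%E.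
Proof.
apply: ereal_sup_ubound; exists 0%N, (fun=> 0), (fun=> z); split => //.
by rewrite big_ord0.
Qed.

Lemma BV_norm_le f (b v : R) : 0 <= v ->
  BV_bound f b v -> (BV_norm f <= (b + v)%:E)%E.
Proof.
move=> v0 [fb fv]; rewrite /BV_norm EFinD; apply: leeD.
  by apply: ge_ereal_sup => _ [z _ <-]; rewrite lee_fin.
apply: ge_ereal_sup => _ [gamma cg <-].
have [vy|] := ltP (vf gamma) +oo%E; last first.
  by rewrite leye_eq /rho => /eqP ->; rewrite invey mul0e lee_fin.
have [N N1 vN] := vf_real vy.
have N0 : 0 < N := lt_le_trans ltr01 N1.
rewrite /rho vN inver gt_eqF // muleC lee_pdivrMr // -EFinM.
apply: ge_ereal_sup => _ [n [t [s [t01 tm st ->]]]]; rewrite lee_fin.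
exact: (fv gamma N n t s).
Qed.

Lemma rho_ge0 gamma : (0%:E <= rho gamma)%E.
Proof. by rewrite /rho inve_ge0 (le_trans _ (vf_ge1 gamma)) // lee_fin. Qed.

Lemma sup_norm_ge0 f : sigma !=set0 -> (0%:E <= sup_norm f)%E.
Proof.
case=> z0 sz0; pose z : sigma := exist _ z0 (mem_set sz0).
apply: le_trans (_ : (rnorm (f z))%:E <= _)%E; first by rewrite lee_fin rnorm_ge0.
by apply: ereal_sup_ubound; exists z.
Qed.

Lemma var_ge0 f : sigma !=set0 -> (0%:E <= var f)%E.
Proof.
case=> z0 sz0; pose o : R -> R[i] := fun=> 0.
have curve0 : curve o by move=> x; exact: cvg_cst.
apply: (@le_trans _ _ (rho o * cvar f o)%E).
  apply: mule_ge0; first exact: rho_ge0.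
  exact: (cvar_ge0 _ _ (exist _ z0 (mem_set sz0))).
by apply: ereal_sup_ubound; exists o.
Qed.

(** Nonemptiness matters: on the empty set the sup norm is -oo. *)
Lemma BV_bounds f : sigma !=set0 -> BV f ->
  exists b v : R, [/\ 0 <= b, 0 <= v & BV_bound f b v].
Proof.
move=> s0 BVf; have sup0 := sup_norm_ge0 f s0; have var0 := var_ge0 f s0.
move: BVf; rewrite /BV /= /BV_norm.
case E1 : (sup_norm f) sup0 => [b| |] //; rewrite ?addye ?ltxx //; last first.
  by case: (var f) var0.
case E2 : (var f) var0 => [v| |] //; rewrite !lee_fin => v0 b0 _.
exists b, v; split => //; split => [w|gamma N n t s cg vN [t01 tm st]].
  by rewrite -lee_fin -E1; apply: ereal_sup_ubound; exists w.
have N0 : 0 < N by rewrite (lt_le_trans ltr01) // -lee_fin -vN vf_ge1.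
rewrite -ler_pdivrMr // -lee_fin -E2.
apply: (@le_trans _ _ (rho gamma * cvar f gamma)%E); last first.
  by apply: ereal_sup_ubound; exists gamma.
rewrite /rho vN inver gt_eqF // mulrC EFinM lee_pmul2l ?lte_fin ?invr_gt0 //.
by apply: ereal_sup_ubound; exists n, t, s.
Qed.

Lemma BV_boundD f g b v b' v' :
  BV_bound f b v -> BV_bound g b' v' -> BV_bound (f + g) (b + b') (v + v').
Proof.
move=> [fb fv] [gb gv]; split=> [z|gamma N n t s cg vN ch].
  by apply: le_trans (ler_rnormD _ _) _; exact: lerD.
rewrite mulrDl; apply: le_trans (lerD (fv _ _ _ _ _ cg vN ch) (gv _ _ _ _ _ cg vN ch)).
rewrite -big_split /=; apply: ler_sum => i _.
set p := s i.+1; set q := s i.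
have -> : (f + g) p - (f + g) q = (f p - f q) + (g p - g q) by rewrite fctE; ring.
exact: ler_rnormD.
Qed.

Lemma BV_boundZ (a : R[i]) f b v :
  BV_bound f b v -> BV_bound (a *: f) (rnorm a * b) (rnorm a * v).
Proof.
move=> [fb fv]; split=> [z|gamma N n t s cg vN ch].
  by rewrite rnormZ ler_wpM2l ?rnorm_ge0.
rewrite -mulrA; apply: le_trans (ler_wpM2l (rnorm_ge0 a) (fv _ _ _ _ _ cg vN ch)).
rewrite mulr_sumr; apply: ler_sum => i _.
by rewrite -scalerBr rnormZ.
Qed.

Lemma BV_boundM f g b v b' v' : 0 <= b -> 0 <= b' ->
  BV_bound f b v -> BV_bound g b' v' ->
  BV_bound (f * g) (b * b') (b * v' + b' * v).
Proof.
move=> b0 b'0 [fb fv] [gb gv]; split=> [z|gamma N n t s cg vN ch].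
  by rewrite rnormM ler_pM ?rnorm_ge0.
rewrite mulrDl -!mulrA.
apply: le_trans (lerD (ler_wpM2l b0 (gv _ _ _ _ _ cg vN ch))
                      (ler_wpM2l b'0 (fv _ _ _ _ _ cg vN ch))).
rewrite !mulr_sumr -big_split /=; apply: ler_sum => i _.
set p := s i.+1; set q := s i.
have -> : (f * g) p - (f * g) q = f p * (g p - g q) + g q * (f p - f q).
  by rewrite fctE; ring.
apply: le_trans (ler_rnormD _ _) _; rewrite !rnormM.
by rewrite lerD // ler_wpM2r ?rnorm_ge0.
Qed.

Lemma BV_bound_BV f b v : 0 <= v -> BV_bound f b v -> BV f.
Proof. by move=> v0 /(BV_norm_le v0) fbv; apply: le_lt_trans fbv _; exact: ltey. Qed.

Definition bounded_lipschitz f (b L : R) : Prop :=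
  (forall z, rnorm (f z) <= b) /\
  forall z w, rnorm (f z - f w) <= L * rnorm (val z - val w).

(** The increments of f are controlled by those of both coordinates; the coordinates
    lie in [-K, K], so their variation along gamma is at most 2 K vf(gamma). *)
Lemma bounded_lipschitz_BV_bound (K : R) f b L :
  (forall z, sigma z -> rnorm z <= K) -> 0 <= L ->
  bounded_lipschitz f b L -> BV_bound f b (4 * K * L).
Proof.
move=> sK L0 [fb fL]; split => // gamma N n t s cg vN [t01 tm st].
have sKr (c z : R[i]) : rnorm c = 1 -> sigma z -> - K <= complex.Re (c * z) <= K.
  move=> c1 /sK zK; rewrite -ler_norml (le_trans (Re_le_rnorm _)) //.
  by rewrite rnormM c1 mul1r.
case: n t01 tm st => [|n] t01 tm st /=.
  have N0 : 0 <= N by rewrite (le_trans ler01) // -lee_fin -vN vf_ge1.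
  have K0 : 0 <= K.
    by apply: le_trans (rnorm_ge0 (val (s 0%N))) (sK _ _); exact: set_valP.
  by rewrite big_ord0 !mulr_ge0.
have var_c (c : R[i]) : rnorm c = 1 ->
    \sum_(i < n) `|complex.Re (c * val (s i.+1)) - complex.Re (c * val (s i))| <=
    N * (K - - K).
  move=> c1; apply: (@sum_variation_le _ (fun i => complex.Re (c * val (s i)))).
    by move=> i _; apply: sKr => //; exact: set_valP.
  move=> x; apply: le_trans (crossings_le_vf (n := n) x c1 cg vN t01 tm).
  rewrite ler_nat leq_sum // => i _.
  by rewrite !st ?leqnn // ltnS ?(ltnW (ltn_ord i)) ?(ltn_ord i).
have c1 : rnorm (1 : R[i]) = 1 by rewrite (rnormr 1) normr1.
apply: (@le_trans _ _ (\sum_(i < n) L *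
    (`|complex.Re (1 * val (s i.+1)) - complex.Re (1 * val (s i))| +
     `|complex.Re ('i%C * val (s i.+1)) - complex.Re ('i%C * val (s i))|))).
  apply: ler_sum => i _; apply: le_trans (fL _ _) _; rewrite ler_wpM2l //.
  apply: le_trans (rnorm_le_ReIm _) _.
  rewrite -!raddfB /= -!mulrBr mul1r lerD2l.
  by case: (_ - _) => p q /=; rewrite mul0r mul1r sub0r normrN.
rewrite -mulr_sumr big_split /=.
apply: le_trans (ler_wpM2l L0 (lerD (var_c _ c1) (var_c _ (@rnorm_i R)))) _.
by rewrite le_eqVlt; apply/orP; left; apply/eqP; ring.
Qed.

Lemma bounded_lipschitz_BV_norm (K : R) f b L :
  (forall z, sigma z -> rnorm z <= K) -> 0 <= K -> 0 <= L ->
  bounded_lipschitz f b L -> (BV_norm f <= (b + 4 * K * L)%:E)%E.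
Proof.
move=> sK K0 L0 /(bounded_lipschitz_BV_bound sK L0); apply: BV_norm_le.
by rewrite !mulr_ge0.
Qed.

End variation.

(** * The algebra AC *)

Section AC_algebra.
Variables (R : realType) (sigma : set R[i]).
Implicit Types f g : sigma -> R[i].

Lemma AC_one : AC (1 : sigma -> R[i]).
Proof. by move=> A [_ sA]; apply: sA; left; left. Qed.

Lemma AC_lambda : AC (@lambda R sigma).
Proof. by move=> A [_ sA]; apply: sA; left; right. Qed.

Lemma AC_lambda_bar : AC (@lambda_bar R sigma).
Proof. by move=> A [_ sA]; apply: sA; right. Qed.

Lemma AC_add f g : AC f -> AC g -> AC (fun z => f z + g z).
Proof.
move=> ACf ACg A cA; case: (cA) => [[_ [AD _ _ _]] _].
by apply: (AD f g); [exact: ACf | exact: ACg].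
Qed.

Lemma AC_scale a f : AC f -> AC (fun z => a * f z).
Proof. by move=> ACf A cA; case: (cA) => [[_ [_ AZ _ _]] _]; apply: (AZ a f);
  exact: ACf. Qed.

Lemma AC_mul f g : AC f -> AC g -> AC (fun z => f z * g z).
Proof.
move=> ACf ACg A cA; case: (cA) => [[_ [_ _ AM _]] _].
by apply: (AM f g); [exact: ACf | exact: ACg].
Qed.

Lemma AC_closed f : BV f ->
  (forall e : R, 0 < e -> exists2 g, AC g & (BV_norm (f - g)%R < e%:E)%E) -> AC f.
Proof.
move=> BVf fe A cA; case: (cA) => [[_ [_ _ _ Acl]] _]; apply: Acl => // e /fe[g ACg ge].
by exists g => //; exact: ACg.
Qed.

Lemma AC_cst (a : R[i]) : AC ((fun=> a) : sigma -> R[i]).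
Proof.
have -> : (fun=> a) = a *: (1 : sigma -> R[i]).
  by apply/funext => z; rewrite -[LHS]mulr1.
exact: (AC_scale a AC_one).
Qed.

Lemma AC_sub f g : AC f -> AC g -> AC (fun z => f z - g z).
Proof.
move=> ACf ACg; under eq_fun do rewrite -mulN1r.
exact: (AC_add ACf (AC_scale _ ACg)).
Qed.

Lemma AC_exp f n : AC f -> AC (fun z => f z ^+ n).
Proof.
move=> ACf; elim: n => [|n IHn]; first exact: AC_cst.
by rewrite (_ : (fun z => _) = f * (fun z => f z ^+ n));
  [exact: AC_mul | apply/funext => z; rewrite exprS].
Qed.

Lemma AC_sum n (F : nat -> sigma -> R[i]) :
  (forall i, (i < n)%N -> AC (F i)) -> AC (fun z => \sum_(i < n) F i z).
Proof.
elim: n => [|n IHn] ACF.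
  rewrite (_ : (fun z => _) = fun=> 0); first exact: AC_cst.
  by apply/funext => z; rewrite big_ord0.
rewrite (_ : (fun z => _) = (fun z => \sum_(i < n) F i z) + F n).
  by apply: AC_add; [apply: IHn => i ni; apply: ACF; exact: ltnW | exact: ACF].
by apply/funext => z; rewrite big_ord_recr.
Qed.

End AC_algebra.

(** * Lipschitz functions *)

Section lipschitz.
Variables (R : realType) (sigma : set R[i]).
Implicit Types f g : sigma -> R[i].

Lemma bounded_lipschitz_weaken f (b L b' L' : R) : b <= b' -> L <= L' ->
  bounded_lipschitz f b L -> bounded_lipschitz f b' L'.
Proof.
move=> bb LL [fb fL]; split => [z|z w]; first exact: le_trans (fb z) bb.
by apply: le_trans (fL z w) _; rewrite ler_wpM2r ?rnorm_ge0.
Qed.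

Lemma bounded_lipschitzD f g (b L b' L' : R) :
  bounded_lipschitz f b L -> bounded_lipschitz g b' L' ->
  bounded_lipschitz (fun z => f z + g z) (b + b') (L + L').
Proof.
move=> [fb fL] [gb gL]; split => [z|z w].
  by apply: le_trans (ler_rnormD _ _) _; exact: lerD.
rewrite (_ : _ - _ = (f z - f w) + (g z - g w)); last by ring.
by apply: le_trans (ler_rnormD _ _) _; rewrite mulrDl lerD.
Qed.

Lemma bounded_lipschitzM f g (b L b' L' : R) : 0 <= b -> 0 <= b' ->
  bounded_lipschitz f b L -> bounded_lipschitz g b' L' ->
  bounded_lipschitz (fun z => f z * g z) (b * b') (b * L' + b' * L).
Proof.
move=> b0 b'0 [fb fL] [gb gL]; split => [z|z w].
  by rewrite rnormM ler_pM ?rnorm_ge0.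
rewrite (_ : _ - _ = f z * (g z - g w) + g w * (f z - f w)); last by ring.
apply: le_trans (ler_rnormD _ _) _; rewrite !rnormM mulrDl -!mulrA.
by rewrite lerD // ler_pM ?rnorm_ge0.
Qed.

(** The obvious Lipschitz constant n b^(n-1) L of f^n is at most C q^n for any
    q > b; the condition on C is what makes the induction close. *)
Lemma bounded_lipschitzX f (b L q C : R) n : 0 <= b -> 0 <= L -> b <= q -> 0 <= C ->
  L <= C * (q - b) -> bounded_lipschitz f b L ->
  bounded_lipschitz (fun z => f z ^+ n) (b ^+ n) (C * q ^+ n).
Proof.
move=> b0 L0 bq C0 LC fbL; elim: n => [|n IHn].
  split => [z|z w]; first by rewrite !expr0 (rnormr 1) normr1.
  by rewrite !expr0 subrr rnorm0 !mulr_ge0 ?rnorm_ge0.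
have bn0 : 0 <= b ^+ n by rewrite exprn_ge0.
have := bounded_lipschitzM b0 bn0 fbL IHn.
rewrite -exprS; under eq_fun do rewrite -exprS.
apply: bounded_lipschitz_weaken => //.
have bqn : b ^+ n <= q ^+ n by rewrite lerXn2r // nnegrE ?(le_trans b0).
have qn0 := le_trans bn0 bqn.
have := ler_pM bn0 L0 bqn LC.
rewrite exprS; lra.
Qed.

Lemma bounded_lipschitzX1 f (L : R) n :
  0 <= L -> bounded_lipschitz f 1 L ->
  bounded_lipschitz (fun z => f z ^+ n) 1 (n%:R * L).
Proof.
move=> L0 fL; elim: n => [|n IHn].
  split=> [z|z w]; first by rewrite expr0 (rnormr 1) normr1.
  by rewrite !expr0 subrr rnorm0 !mul0r.
have := bounded_lipschitzM ler01 ler01 fL IHn.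
under eq_fun do rewrite -exprS.
by apply: bounded_lipschitz_weaken; rewrite ?mulr1 // -natr1; lra.
Qed.

Lemma bounded_lipschitzV f (b L m : R) : 0 < m -> 0 <= L ->
  (forall z, m <= rnorm (f z)) -> bounded_lipschitz f b L ->
  bounded_lipschitz (fun z => (f z)^-1) m^-1 (L / m ^+ 2).
Proof.
move=> m0 L0 mf [_ fL].
have f0 z : f z != 0.
  by apply/eqP => /(congr1 (@rnorm _ _)); rewrite rnorm0 => e; have := mf z;
    rewrite e leNgt m0.
have rnormV z : rnorm (f z)^-1 = (rnorm (f z))^-1.
  have n0 : rnorm (f z) != 0 by rewrite gt_eqF // (lt_le_trans m0).
  by apply: (mulfI n0); rewrite -rnormM !divff // (rnormr 1) normr1.
have fV z : (rnorm (f z))^-1 <= m^-1 by rewrite lef_pV2 // posrE (lt_le_trans m0).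
have fV0 z : 0 <= (rnorm (f z))^-1 by rewrite invr_ge0 rnorm_ge0.
split => [z|z w]; first by rewrite rnormV.
rewrite (_ : _ - _ = (f w - f z) * ((f z)^-1 * (f w)^-1)); last first.
  by field; rewrite !f0.
rewrite !rnormM !rnormV rnormB.
have -> : L / m ^+ 2 * rnorm (val z - val w) =
          L * rnorm (val z - val w) * (m^-1 * m^-1).
  by field; rewrite gt_eqF.
apply: ler_pM => //; first by rewrite rnorm_ge0.
- by rewrite mulr_ge0.
- exact: ler_pM.
Qed.

Lemma bounded_lipschitz_sum n (F : nat -> sigma -> R[i]) (b L : R) :
  (forall i, bounded_lipschitz (F i) b L) ->
  bounded_lipschitz (fun z => \sum_(i < n) F i z) (n%:R * b) (n%:R * L).
Proof.
move=> FbL; elim: n => [|n IHn].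
  by split => [z|z w]; rewrite !big_ord0 ?subrr rnorm0 !mul0r.
under eq_fun do rewrite big_ord_recr /=.
by rewrite -natr1 !mulrDl !mul1r; exact: bounded_lipschitzD.
Qed.

End lipschitz.

(** * Inverses in AC *)

Section inverse.
Variables (R : realType) (sigma : set R[i]) (K : R).
Hypothesis K0 : 0 <= K.
Hypothesis sigmaK : forall z, sigma z -> rnorm z <= K.

Lemma bounded_lipschitz_BV (f : sigma -> R[i]) b L : 0 <= L ->
  bounded_lipschitz f b L -> BV f.
Proof.
move=> L0 /(bounded_lipschitz_BV_norm sigmaK K0 L0) fbL.
by apply: le_lt_trans fbL _; exact: ltey.
Qed.

(** With G = 1 - f/B, where B bounds f, one has 1/f = (1/B) sum G^k, and the n-th
    remainder G^n / f tends to 0 geometrically in sup norm and in Lipschitz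
    constant, hence in the BV norm. *)
Lemma AC_inv (f : sigma -> R) (m b L : R) : 0 < m -> 0 <= L ->
  (forall z, m <= f z) -> bounded_lipschitz (fun z => (f z)%:C) b L ->
  AC (fun z => (f z)%:C) -> AC (fun z => (f z)%:C^-1).
Proof.
move=> m0 L0 mf fbL ACf.
have f0 z : 0 < f z := lt_le_trans m0 (mf z).
have mfn z : m <= rnorm (f z)%:C by rewrite rnormr ger0_norm // ltW.
have VbL := bounded_lipschitzV m0 L0 mfn fbL.
have Lm0 : 0 <= L / m ^+ 2 by rewrite divr_ge0 // exprn_ge0 // ltW.
apply: AC_closed; first exact: bounded_lipschitz_BV VbL.
move=> e e0; pose B := `|b| + m.
have B0 : 0 < B by rewrite ltr_wpDl.
pose G z := 1 - (B^-1)%:C * (f z)%:C.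
pose th := 1 - m / B; pose q := (1 + th) / 2.
have mB : 0 < m / B <= 1.
  by rewrite divr_gt0 //= ler_pdivrMr // mul1r lerDr.
have th0 : 0 <= th by rewrite /th; lra.
have thq : th < q by rewrite /q /th; lra.
have q01 : 0 <= q < 1 by rewrite /q /th; lra.
have qth : 0 < q - th by rewrite subr_gt0.
have GbL : bounded_lipschitz G th (L / B).
  split => [z|z w].
    rewrite /G -rmorphM -(rmorph1 (real_complex R)) -rmorphB /= rnormr ger0_norm.
      by rewrite /th lerD2l lerN2 mulrC ler_wpM2l // invr_ge0 ltW.
    rewrite subr_ge0 mulrC ler_pdivrMr // mul1r.
    have := fbL.1 z; rewrite rnormr (ger0_norm (ltW (f0 z))) => /le_trans; apply.
    by rewrite (le_trans (ler_norm b)) // lerDl ltW.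
  rewrite /G (_ : _ - _ = (B^-1)%:C * ((f w)%:C - (f z)%:C)); last by ring.
  rewrite rnormM rnormr ger0_norm ?invr_ge0 ?(ltW B0) // rnormB.
  by rewrite [leRHS]mulrAC [leRHS]mulrC ler_wpM2l ?invr_ge0 ?(ltW B0) //; exact: fbL.2.
pose C := L / B / (q - th).
have C0 : 0 <= C by rewrite !divr_ge0 // ltW.
have GnL n : bounded_lipschitz (fun z => G z ^+ n) (th ^+ n) (C * q ^+ n).
  apply: (bounded_lipschitzX n th0 _ (ltW thq) C0 _ GbL);
    first by rewrite divr_ge0 // ltW.
  by rewrite /C divfK // gt_eqF.
pose D := m^-1 + 4 * K * (L / m ^+ 2 + m^-1 * C).
have mV0 : 0 <= m^-1 by rewrite invr_ge0 ltW.
have D0 : 0 <= D by rewrite addr_ge0 // mulr_ge0 ?mulr_ge0 // addr_ge0 // mulr_ge0.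
have [n qn] : exists n, q ^+ n < e / (D + 1).
  have q1 : `|q| < 1 by rewrite ger0_norm; case/andP: q01.
  have /cvgrPdist_lt /(_ (e / (D + 1))) := cvg_expr q1.
  rewrite divr_gt0 ?ltr_pwDr // => /(_ isT) [n _ /(_ n (leqnn n))] /=.
  by rewrite sub0r normrN; exists n; apply: le_lt_trans (ler_norm _) _.
exists (fun z => (B^-1)%:C * \sum_(k < n) G z ^+ k).
  have ACG : AC G := AC_sub (AC_cst 1) (AC_scale _ ACf).
  exact: AC_scale (AC_sum (fun k _ => AC_exp k ACG)).
rewrite (_ : _ - _ = (fun z => (f z)%:C^-1 * G z ^+ n)); last first.
  apply/funext => z.
  rewrite [LHS](_ : _ = (f z)%:C^-1 - (B^-1)%:C * (\sum_(k < n) G z ^+ k)) //.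
  have fz : (f z)%:C != 0 :> R[i] by rewrite fmorph_eq0 gt_eqF.
  have BC : (B%:C : R[i]) != 0 by rewrite fmorph_eq0 gt_eqF.
  have e1 : (\sum_(k < n) G z ^+ k) * (1 - G z) = 1 - G z ^+ n.
    by rewrite -[1 - G z ^+ n]opprB subrX1; ring.
  have e2 : 1 - G z = (f z)%:C / B%:C by rewrite /G fmorphV; ring.
  have -> : \sum_(k < n) G z ^+ k = (1 - G z ^+ n) * (B%:C / (f z)%:C).
    by rewrite -e1 e2; field; rewrite fz.
  by rewrite fmorphV; field; rewrite fz.
have := bounded_lipschitzM mV0 (exprn_ge0 n th0) VbL (GnL n).
move=> /(bounded_lipschitz_BV_norm sigmaK K0) h.
have thqn : th ^+ n <= q ^+ n by rewrite lerXn2r // ?nnegrE ?(ltW thq) //;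
  case/andP: q01.
have qn0 : 0 <= q ^+ n by apply: le_trans thqn; rewrite exprn_ge0.
apply: le_lt_trans (h _) _.
  by apply: addr_ge0; apply: mulr_ge0 => //; [exact: mulr_ge0|exact: exprn_ge0].
rewrite lte_fin; apply: (@le_lt_trans _ _ (D * q ^+ n)).
  have : th ^+ n * (m^-1 + 4 * K * (L / m ^+ 2)) <= q ^+ n * (m^-1 + 4 * K * (L / m ^+ 2)).
    by rewrite ler_wpM2r // addr_ge0 // mulr_ge0 // mulr_ge0.
  by rewrite /D; lra.
move: qn; rewrite ltr_pdivlMr ?ltr_pwDr // => qn; apply: le_lt_trans qn.
by rewrite mulrC ler_wpM2l // lerDl.
Qed.

(** Reduction to the real case by 1/f = conj(f) / |f|^2. *)
Lemma AC_inv_complex (f : sigma -> R[i]) (m b L : R) : 0 < m -> 0 <= b -> 0 <= L ->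
  (forall z, m <= rnorm (f z)) -> bounded_lipschitz f b L ->
  AC f -> AC (fun z => (f z)^*) -> AC (fun z => (f z)^-1).
Proof.
move=> m0 b0 L0 mf fbL ACf ACfJ.
have fJbL : bounded_lipschitz (fun z => (f z)^*) b L.
  have [fb fL] := fbL; split=> [z|z w]; first by rewrite rnormJ.
  by rewrite -rmorphB rnormJ.
have := bounded_lipschitzM b0 b0 fbL fJbL.
under eq_fun do rewrite mulrJ.
move=> f2bL; rewrite (_ : (fun z => _) = fun z => (f z)^* * (rnorm (f z) ^+ 2)%:C^-1).
  apply: (AC_mul ACfJ).
  apply: (AC_inv (m := m ^+ 2) _ _ _ f2bL).
  - by rewrite exprn_gt0.
  - by rewrite addr_ge0 // mulr_ge0.
  - by move=> z; rewrite lerXn2r // nnegrE ?rnorm_ge0 // ltW.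
  - by under eq_fun do rewrite -mulrJ; exact: AC_mul.
apply/funext => z; rewrite -mulrJ.
have f0 : f z != 0.
  by apply/eqP => /(congr1 (@rnorm _ _)); rewrite rnorm0 => e; have := mf z;
    rewrite e leNgt m0.
have fJ0 : (f z)^* != 0.
  by apply/eqP => /(congr1 (@rnorm _ _)); rewrite rnormJ rnorm0 => e;
    have := mf z; rewrite e leNgt m0.
by field; rewrite f0 fJ0.
Qed.

End inverse.

(** * Composition with a real part *)

Section projection.
Variables (R : realType) (sigma J : set R[i]) (c : R[i]).
Variable pi : sigma -> J.
Hypothesis c1 : rnorm c = 1.
Hypothesis piE : forall z, val (pi z) = real_part c (val z).

Lemma curve_real_part gamma : curve gamma -> curve (real_part c \o gamma).
Proof.
apply: (lipschitz_within_continuousC (K := 1)) => z w.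
rewrite /real_part -rmorphB /= rnormr -raddfB /= -mulrBr.
by rewrite (le_trans (Re_le_rnorm _)) // rnormM c1.
Qed.

Lemma rho_real_part (gamma : R -> R[i]) : (rho gamma <= rho (real_part c \o gamma))%E.
Proof.
rewrite /rho lee_pV2 ?vf_real_part // inE.
  by rewrite (le_trans _ (vf_ge1 _)) // lee_fin.
by rewrite (le_trans _ (vf_ge1 _)) // lee_fin.
Qed.

(** A chain on gamma in sigma projects to a chain on the projected curve, whose weight
    is at least that of gamma. *)
Lemma BV_norm_comp (f : J -> R[i]) : sigma !=set0 ->
  (BV_norm (f \o pi) <= BV_norm f)%E.
Proof.
case=> z0 sz0; apply: leeD.
  by apply: ge_ereal_sup => _ [z _ <-]; apply: ereal_sup_ubound; exists (pi z).
apply: ge_ereal_sup => _ [gamma cg <-].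
apply: (@le_trans _ _ (rho (real_part c \o gamma) * cvar f (real_part c \o gamma))%E); last first.
  apply: ereal_sup_ubound; exists (real_part c \o gamma); last by reflexivity.
  exact: curve_real_part.
apply: lee_pmul;
  [exact: rho_ge0 | exact: (cvar_ge0 _ _ (exist _ z0 (mem_set sz0))) | exact: rho_real_part|].
apply: ge_ereal_sup => _ [n [t [s [t01 tm st ->]]]].
apply: ereal_sup_ubound; exists n, t, (pi \o s); split => // i ni.
by rewrite /= piE st.
Qed.

(** The functions g in BV(J) with g o pi in a given closed subalgebra A form a closed
    subalgebra, by the norm estimate; its generators are 1 and the identity
    of J, which is sent to the combination (c z + conj(c z)) / 2 of the
    generators for sigma. *)
Lemma AC_comp (K : R) (f : J -> R[i]) : sigma !=set0 ->
  (forall z, J z -> rnorm z <= K) -> (forall z, J z -> complex.Im z = 0) ->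
  AC f -> AC (f \o pi).
Proof.
move=> s0 JK JR ACf A [[cA [AD AZ AM Acl]] As].
have [z0 sz0] := s0; have J0 : J !=set0.
  by exists (val (pi (exist _ z0 (mem_set sz0)))); exact: set_valP.
pose A' := [set g : J -> R[i] | BV g /\ A (g \o pi)].
have K0 : 0 <= K by have [z Jz] := J0; exact: le_trans (rnorm_ge0 z) (JK z Jz).
suff : A' f by case.
apply: ACf; split.
  split; first by move=> g [].
  split.
  - move=> g h [BVg Ag] [BVh Ah]; split; last exact: (AD _ _ Ag Ah).
    have [b [v [b0 v0 gbv]]] := BV_bounds J0 BVg;
      have [b' [v' [b'0 v'0 hbv]]] := BV_bounds J0 BVh.
    by apply: BV_bound_BV (BV_boundD gbv hbv); exact: addr_ge0.
  - move=> a g [BVg Ag]; split; last exact: (AZ a _ Ag).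
    have [b [v [b0 v0 gbv]]] := BV_bounds J0 BVg.
    by apply: BV_bound_BV (BV_boundZ a gbv); rewrite mulr_ge0 ?rnorm_ge0.
  - move=> g h [BVg Ag] [BVh Ah]; split; last exact: (AM _ _ Ag Ah).
    have [b [v [b0 v0 gbv]]] := BV_bounds J0 BVg;
      have [b' [v' [b'0 v'0 hbv]]] := BV_bounds J0 BVh.
    by apply: BV_bound_BV (BV_boundM b0 b'0 gbv hbv); rewrite addr_ge0 ?mulr_ge0.
  - move=> g BVg gcl; split=> //; apply: Acl.
      exact: le_lt_trans (BV_norm_comp g s0) BVg.
    move=> e /gcl[h [BVh Ah] gh]; exists (h \o pi) => //.
    exact: le_lt_trans (BV_norm_comp (g - h) s0) gh.
have re_A : A (fun z => real_part c (val z)).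
  suff -> : (fun z : sigma => real_part c (val z)) =
      (c / 2) *: @lambda R sigma + (c^* / 2) *: @lambda_bar R sigma.
    by apply: AD; apply: AZ; apply: As; [left; right | right].
  apply/funext => z; rewrite /real_part /lambda /lambda_bar ReJ_add.
  rewrite [RHS](_ : _ = (c / 2) * val z + (c^* / 2) * (val z)^*) // rmorphM /=; ring.
have lambdaBV : BV (@lambda R J).
  apply: (bounded_lipschitz_BV K0 JK ler01); split => [z|z w].
    by apply: JK; exact: set_valP.
  by rewrite mul1r.
have conj_real (w : R[i]) : complex.Im w = 0 -> w^* = w.
  by case: w => p q /= ->; apply/eqP; rewrite eq_complex /= oppr0 !eqxx.
have barE : @lambda_bar R J = @lambda R J.
  apply/funext => z; rewrite /lambda_bar /lambda.
  exact: conj_real (JR _ (set_valP z)).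
have lA : A (@lambda R J \o pi).
  by rewrite (_ : _ \o _ = fun z => real_part c (val z)) //; apply/funext => z;
    rewrite /= /lambda piE.
move=> g [[->|->]|->]; last by rewrite barE; split.
  split; last by apply: As; left; left.
  apply: (bounded_lipschitz_BV (b := 1) K0 JK (lexx 0)); split => [z|z w].
    by rewrite (rnormr 1) normr1.
  by rewrite subrr rnorm0 mul0r.
by split.
Qed.

End projection.

(** * Bounded operators and approximate inverses *)

Section bounded_operators.
Variables (R : realType) (X : completeNormedModType R[i]).
Implicit Types (P U : {linear X -> X}).

Lemma opnorm_leP P (a : R) : 0 <= a ->
  (opnorm P <= a%:E)%E <-> forall x, rnorm (P x) <= a * rnorm x.
Proof.
move=> a0; split=> [Pa x|Pa]; last first.
  apply: ge_ereal_sup => _ [x x1 <-]; rewrite lee_fin (le_trans (Pa x)) //.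
  by rewrite ler_piMr.
have [/rnorm_eq0 ->|x0] := eqVneq (rnorm x) 0; first by rewrite linear0 !rnorm0 mulr0.
have xgt0 : 0 < rnorm x by rewrite lt_neqAle eq_sym x0 rnorm_ge0.
have nV : rnorm ((rnorm x)^-1%:C : R[i]) = (rnorm x)^-1 by rewrite rnormr ger0_norm // invr_ge0 ltW.
have : rnorm (P ((rnorm x)^-1%:C *: x)) <= a.
  rewrite -lee_fin; apply: le_trans Pa; apply: ereal_sup_ubound.
  by exists ((rnorm x)^-1%:C *: x) => //=; rewrite rnormZ nV mulVf.
by rewrite linearZ rnormZ nV mulrC ler_pdivrMr.
Qed.

Lemma bounded_opP P : bounded_op P <->
  exists2 a : R, 0 <= a & forall x, rnorm (P x) <= a * rnorm x.
Proof.
split=> [|[a a0 /(opnorm_leP P a0) Pa]]; last exact: le_lt_trans Pa (ltey _).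
have : (0%:E <= opnorm P)%E.
  apply: ereal_sup_ubound; exists 0; first by rewrite /= rnorm0.
  by rewrite linear0 rnorm0.
rewrite /bounded_op; case E : (opnorm P) => [a| |] //; rewrite lee_fin => a0 _.
by exists a => //; apply/(opnorm_leP P a0); rewrite E.
Qed.

Definition bounded_inverse P U : Prop :=
  [/\ bounded_op U, forall x, U (P x) = x & forall x, P (U x) = x].

(** Solve P y = x by successive corrections: the residual after n corrections is at
    most 2^-n |x|, so the corrections V r_n are summable. V need not be linear. *)
Lemma approx_surjective P (V : X -> X) (a : R) : bounded_op P ->
  (forall x, rnorm (V x) <= a * rnorm x) ->
  (forall x, rnorm (x - P (V x)) <= 2^-1 * rnorm x) ->
  forall x, exists y, P y = x.
Proof.
move=> /bounded_opP[p p0 Pp] Va PV x.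
pose r n := iter n (fun y => y - P (V y)) x.
have rn n : rnorm (r n) <= 2^-1 ^+ n * rnorm x.
  elim: n => [|n IHn]; first by rewrite mul1r.
  rewrite exprS -mulrA; apply: le_trans (PV _) _.
  by rewrite ler_wpM2l.
pose y n := \sum_(k < n) V (r k).
have Py n : P (y n) = x - r n.
  elim: n => [|n IHn]; first by rewrite /y big_ord0 linear0 subrr.
  rewrite /y big_ord_recr /= linearD -/(y n) IHn /=.
  by rewrite opprB addrA addrAC.
have a0 : 0 <= `|a| by [].
have ystep n m : rnorm (y (n + m)%N - y n) <= 2^-1 ^+ n * (2 * `|a| * rnorm x) * (1 - 2^-1 ^+ m).
  elim: m => [|m IHm]; first by rewrite addn0 subrr rnorm0 expr0 subrr mulr0.
  rewrite addnS /y big_ord_recr /= -/(y _) addrAC; apply: le_trans (ler_rnormD _ _) _.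
  apply: le_trans (lerD IHm (Va _)) _.
  have : a * rnorm (r (n + m)%N) <= `|a| * (2^-1 ^+ (n + m) * rnorm x).
    apply: le_trans (ler_wpM2l a0 (rn _)).
    by rewrite ler_wpM2r ?rnorm_ge0 // ler_norm.
  rewrite exprD exprS.
  set u := 2^-1 ^+ n; set v := 2^-1 ^+ m; set N := rnorm x; set A := `|a|.
  have -> : A * (u * v * N) = u * (2 * A * N) * (v - 2^-1 * v) by field.
  lra.
pose D := 2 * `|a| * rnorm x.
have D0 : 0 <= D by rewrite mulr_ge0 ?rnorm_ge0 // mulr_ge0.
have geom (e : R) : 0 < e -> exists n, 2^-1 ^+ n * (D + rnorm x) < e.
  move=> e0; have h1 : `|2^-1 : R| < 1 by rewrite ger0_norm // invf_lt1 // ltr1n.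
  have Dx : 0 <= D + rnorm x by rewrite addr_ge0 ?rnorm_ge0.
  have /cvgrPdist_lt /(_ (e / (D + rnorm x + 1))) := cvg_expr h1.
  rewrite divr_gt0 ?ltr_pwDr // => /(_ isT) [n _ /(_ n (leqnn n))] /=.
  rewrite sub0r normrN ger0_norm ?exprn_ge0 // ltr_pdivlMr ?ltr_pwDr // => ne.
  by exists n; apply: le_lt_trans ne; rewrite ler_wpM2l ?exprn_ge0 // lerDl.
have ydist n m : (n <= m)%N -> rnorm (y m - y n) <= 2^-1 ^+ n * D.
  move=> /subnKC <-; apply: le_trans (ystep _ _) _.
  by rewrite mulrBr mulr1 gerBl -/D -mulrA mulr_ge0 ?exprn_ge0 // mulr_ge0 ?exprn_ge0.
have ycauchy : cauchy (y @ \oo).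
  apply: cauchy_exP => e e0.
  move: (e0); rewrite ltcE /= => /andP[im_e re_e]; have [n ne] := geom _ re_e.
  exists (y n); exists n => // m /= nm; rewrite -ball_normE /= rnormE ltcE /= im_e /=.
  rewrite rnormB; apply: le_lt_trans (ydist _ _ nm) _; apply: le_lt_trans ne.
  by rewrite ler_wpM2l ?exprn_ge0 // lerDl rnorm_ge0.
have /cauchy_cvgP/cvg_ex[/= l yl] := ycauchy.
exists l; apply/eqP; rewrite -subr_eq0; apply/eqP; apply: rnorm_eq0.
apply/eqP; rewrite eq_le rnorm_ge0 andbT; apply/ler_addgt0Pl => e e0.
rewrite addr0.
pose q := e / (2 * (p + 1)).
have qe : q * (2 * (p + 1)) = e by rewrite divfK // gt_eqF // mulr_gt0 // ltr_pwDr.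
have q0 : 0 < q by rewrite divr_gt0 // mulr_gt0 // ltr_pwDr.
have [n1 n1e] := geom _ (divr_gt0 e0 (ltr0n R 2)).
have /cvgrPdist_lt /(_ q%:C) := yl.
rewrite ltcR => /(_ q0) [n2 _ /(_ (maxn n1 n2) (leq_maxr _ _))] /=.
rewrite rnormE ltcR => ln.
set n := maxn n1 n2 in ln.
have -> : P l - x = P (l - y n) - r n by rewrite linearB Py opprB addrAC addrA subrK.
apply: le_trans (ler_rnormD _ _) _; rewrite rnormN.
have h1 : rnorm (P (l - y n)) <= e / 2.
  apply: le_trans (Pp _) _; apply: le_trans (ler_wpM2l p0 (ltW ln)) _.
  have := mulr_ge0 p0 (ltW q0); lra.
have h2 : rnorm (r n) <= e / 2.
  apply: le_trans (rn n) _; apply: le_trans (ltW n1e).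
  rewrite ler_pM ?exprn_ge0 ?rnorm_ge0 // ?lerDr //.
  by rewrite ler_wiXn2l // ?leq_maxl // invf_le1 // ler1n.
lra.
Qed.

End bounded_operators.

Section resolvent.
Variables (R : realType) (X : completeNormedModType R[i]).
Implicit Types (P T : {linear X -> X}) (z : R[i]).

(** An approximate left inverse bounds P from below, so P is injective with bounded
    inverse; an approximate right inverse makes P surjective. The two need not
    commute with P nor agree. *)
Lemma approx_invertible P (V1 V2 : X -> X) (a : R) : bounded_op P ->
  (forall x, rnorm (V1 x) <= a * rnorm x) ->
  (forall x, rnorm (V2 x) <= a * rnorm x) ->
  (forall x, rnorm (x - V1 (P x)) <= 2^-1 * rnorm x) ->
  (forall x, rnorm (x - P (V2 x)) <= 2^-1 * rnorm x) ->
  exists U, bounded_inverse P U.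
Proof.
move=> Pb V1a V2a V1P PV2.
have low x : rnorm x <= 2 * a * rnorm (P x).
  have := ler_rnormD (x - V1 (P x)) (V1 (P x)); rewrite subrK.
  by have := V1P x; have := V1a (P x); lra.
have Pinj x y : P x = P y -> x = y.
  move=> e; apply/eqP; rewrite -subr_eq0; apply/eqP/rnorm_eq0/eqP.
  rewrite eq_le rnorm_ge0 andbT; have := low (x - y).
  by rewrite linearB e subrr rnorm0 mulr0.
have [f Pf] := choice (approx_surjective Pb V2a PV2).
have f_lin : linear f.
  by move=> b x y; apply: Pinj; rewrite linearP !Pf.
pose U : {linear X -> X} := HB.pack f (GRing.isLinear.Build R[i] X X _ f f_lin).
exists U; split=> [|x|x]; last exact: Pf.
  apply/bounded_opP; exists `|2 * a| => // x.
  rewrite -{2}[x]Pf; apply: le_trans (low _) _.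
  by rewrite ler_wpM2r ?rnorm_ge0 // ler_norm.
exact/Pinj/Pf.
Qed.

Definition shift z T (x : X) : X := z *: x - T x.

Lemma shift_linear z T : linear (shift z T).
Proof.
move=> a x y; rewrite /shift linearP scalerDr opprD !scalerBr !scalerA [z * a]mulrC.
by rewrite addrACA.
Qed.

HB.instance Definition _ z T :=
  GRing.isLinear.Build R[i] X X _ (shift z T) (shift_linear z T).

Lemma notin_spectrum T z :
  ~ spectrum T z <-> exists U, bounded_inverse (shift z T) U.
Proof.
by split=> [/contrapT[U TU]|[U TU]]; [exists U; exact: TU | apply; exists U; exact: TU].
Qed.

Lemma bounded_shift T z : bounded_op T -> bounded_op (shift z T).
Proof.
move=> /bounded_opP[a a0 Ta]; apply/bounded_opP; exists (rnorm z + a).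
  by rewrite addr_ge0 ?rnorm_ge0.
move=> x; apply: le_trans (ler_rnormD _ _) _.
by rewrite rnormN rnormZ mulrDl lerD2l.
Qed.

(** Locally the bound persists with twice the constant, because moving s by e changes
    the shifted operator by e times the identity; compactness does the rest. *)
Lemma uniform_lower_bound T (r K : R) : 0 <= K ->
  (forall s : R, ~ spectrum T (r%:C + 'i%C * s%:C)) ->
  exists2 a : R, 0 <= a & forall s : R, - K <= s <= K -> forall x,
    rnorm x <= a * rnorm (shift (r%:C + 'i%C * s%:C) T x).
Proof.
move=> K0 rT.
have /compact_near_coveringP cK := @segment_compact R (- K) K.
pose Q (a s : R) := forall x, rnorm x <= a * rnorm (shift (r%:C + 'i%C * s%:C) T x).
have [|a [_ aP]] := cK R +oo%R Q _.
  move=> s _; have /notin_spectrum[U [/bounded_opP[b b0 Ub] UT _]] := rT s.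
  pose e := (2 * (b + 1))^-1.
  have e0 : 0 < e by rewrite invr_gt0 mulr_gt0 // ltr_pwDr.
  have eb : e * (2 * (b + 1)) = 1 by rewrite mulVf // gt_eqF // mulr_gt0 // ltr_pwDr.
  exists ([set s' | `|s - s'| < e], [set a | 2 * b < a]).
    split => /=; last by exists (2 * b); split; [exact: num_real|].
    have /cvgrPdist_lt := (@cvg_id _ (nbhs s)); exact.
  move=> [s' a] /= [ss' ba] x.
  have : shift (r%:C + 'i%C * s%:C) T x =
      shift (r%:C + 'i%C * s'%:C) T x + ('i%C * (s - s')%:C) *: x.
    by rewrite /shift addrAC -scalerDl; congr (_ *: _ - _); rewrite rmorphB /=; ring.
  move=> /(congr1 U); rewrite {1}UT => xE.
  have : rnorm x <=
      b * rnorm (shift (r%:C + 'i%C * s'%:C) T x) + b * (`|s - s'| * rnorm x).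
    rewrite {1}xE linearD; apply: le_trans (ler_rnormD _ _) _; apply: lerD => //.
    by apply: le_trans (Ub _) _; rewrite rnormZ rnormM rnorm_i mul1r rnormr.
  set t := rnorm (shift _ _ _); have t0 : 0 <= t by exact: rnorm_ge0.
  have x0 := rnorm_ge0 x.
  have : b * (`|s - s'| * rnorm x) <= b * (e * rnorm x).
    by rewrite ler_wpM2l // ler_wpM2r // ltW.
  have -> : b * (e * rnorm x) = 2^-1 * rnorm x - e * rnorm x.
    by have := congr1 (fun u => 2^-1 * rnorm x * u) eb; rewrite /= mulr1 => <-; field.
  have : 0 <= e * rnorm x by rewrite mulr_ge0 // ltW.
  have : 0 <= (a - 2 * b) * t by rewrite mulr_ge0 // subr_ge0 ltW.
  lra.
exists (`|a| + 1); first by rewrite addr_ge0.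
move=> s sK; apply: (aP (`|a| + 1)); last by rewrite /= in_itv.
by rewrite (le_lt_trans (ler_norm a)) // ltrDl.
Qed.

End resolvent.

(** * Rational bumps *)

Section kernels.
Variable R : realType.
Implicit Types (t w : R[i]) (d : R).

Definition denom d t : R := rnorm t ^+ 2 + d ^+ 2.

Lemma denom_gt0 d t : 0 < d -> 0 < denom d t.
Proof. by move=> d0; rewrite ltr_wpDl ?sqr_ge0 // exprn_gt0. Qed.

(** A smooth function of size 1 at t = 0 and small for |t| much larger than d,
    whose product with t is d times [wave]. *)
Definition bump d t : R[i] := (d ^+ 2)%:C / (denom d t)%:C.
Definition wave d t : R[i] := d%:C * t / (denom d t)%:C.

Lemma denomC_neq0 d t : 0 < d -> ((denom d t)%:C : R[i]) != 0.
Proof. by move=> d0; rewrite fmorph_eq0 gt_eqF // denom_gt0. Qed.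

Lemma rnormrV (a : R) : 0 < a -> rnorm (a%:C)^-1 = a^-1.
Proof. by move=> a0; rewrite -fmorphV rnormr ger0_norm // invr_ge0 ltW. Qed.

Lemma rnorm_bump_le1 d t : 0 < d -> rnorm (bump d t) <= 1.
Proof.
move=> d0; rewrite /bump rnormM (rnormrV (denom_gt0 t d0)) rnormr ger0_norm ?sqr_ge0 //.
by rewrite ler_pdivrMr ?denom_gt0 // mul1r /denom lerDr sqr_ge0.
Qed.

Lemma rnorm_wave_le1 d t : 0 < d -> rnorm (wave d t) <= 1.
Proof.
move=> d0;
  rewrite /wave rnormM (rnormrV (denom_gt0 t d0)) rnormM rnormr (ger0_norm (ltW d0)).
rewrite ler_pdivrMr ?denom_gt0 // mul1r /denom.
have := rnorm_ge0 t; have := sqr_ge0 (rnorm t - d); rewrite !expr2; nra.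
Qed.

Lemma bump_lipschitz d t w : 0 < d ->
  rnorm (bump d t - bump d w) <= d^-1 * rnorm (t - w).
Proof.
move=> d0; have t0 := denom_gt0 t d0; have w0 := denom_gt0 w d0.
have -> : bump d t - bump d w =
  ((d ^+ 2 * (rnorm w ^+ 2 - rnorm t ^+ 2)) / (denom d t * denom d w))%:C.
  rewrite /bump -!fmorphV -!rmorphM -rmorphB; congr (_%:C).
  by rewrite /denom in t0 w0 *; field; rewrite !gt_eqF.
rewrite rnormr normrM normfV (ger0_norm (ltW (mulr_gt0 t0 w0))).
rewrite ler_pdivrMr ?mulr_gt0 // normrM (ger0_norm (sqr_ge0 d)).
have tw : `|rnorm w ^+ 2 - rnorm t ^+ 2| <= rnorm (t - w) * (rnorm w + rnorm t).
  rewrite subr_sqr normrM (ger0_norm (addr_ge0 (rnorm_ge0 w) (rnorm_ge0 t))).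
  rewrite ler_wpM2r ?addr_ge0 ?rnorm_ge0 // ler_norml; apply/andP; split.
    rewrite rnormB; have := ler_rnormD (t - w) w; rewrite subrK rnormB; lra.
  by have := ler_rnormD (w - t) t; rewrite subrK rnormB; lra.
apply: le_trans (ler_wpM2l (sqr_ge0 d) tw) _.
have -> : d^-1 * rnorm (t - w) * (denom d t * denom d w) =
  rnorm (t - w) * (d^-1 * (denom d t * denom d w)) by ring.
rewrite mulrCA ler_wpM2l ?rnorm_ge0 // [leRHS]mulrC ler_pdivlMr //.
rewrite /denom; set a := rnorm t; set b := rnorm w.
have a0 : 0 <= a by exact: rnorm_ge0.
have b0 : 0 <= b by exact: rnorm_ge0.
have := mulr_ge0 (sqr_ge0 d) (sqr_ge0 (a - d / 2)).
have := mulr_ge0 (sqr_ge0 d) (sqr_ge0 (b - d / 2)).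
have := mulr_ge0 (sqr_ge0 a) (sqr_ge0 b).
have := sqr_ge0 (d ^+ 2).
rewrite !expr2; lra.
Qed.

Lemma wave_lipschitz d t w : 0 < d ->
  rnorm (wave d t - wave d w) <= d^-1 * rnorm (t - w).
Proof.
move=> d0; have t0 := denom_gt0 t d0; have w0 := denom_gt0 w d0.
have tC := denomC_neq0 t d0; have wC := denomC_neq0 w d0.
have -> : wave d t - wave d w =
  d%:C * ((d ^+ 2)%:C * (t - w) + t * w * (w - t)^*) *
  (denom d t)%:C^-1 * (denom d w)%:C^-1.
  rewrite /wave rmorphB; move: tC wC;
    rewrite /denom !rmorphD /= -!mulrJ !rmorphXn => tC wC.
  by field; apply/andP; split.
rewrite !rnormM !rnormrV // rnormr (ger0_norm (ltW d0)).
rewrite -mulrA -invfM ler_pdivrMr ?mulr_gt0 //.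
have h : rnorm ((d ^+ 2)%:C * (t - w) + t * w * (w - t)^*) <=
    (d ^+ 2 + rnorm t * rnorm w) * rnorm (t - w).
  apply: le_trans (ler_rnormD _ _) _;
    rewrite !rnormM rnormJ rnormr (ger0_norm (sqr_ge0 d)).
  by rewrite [rnorm (w - t)]rnormB -mulrDl.
apply: le_trans (ler_wpM2l (ltW d0) h) _.
have -> : d^-1 * rnorm (t - w) * (denom d t * denom d w) =
  rnorm (t - w) * (d^-1 * (denom d t * denom d w)) by ring.
rewrite mulrA mulrC ler_wpM2l ?rnorm_ge0 // [leRHS]mulrC ler_pdivlMr //.
rewrite /denom; set a := rnorm t; set b := rnorm w.
have := mulr_ge0 (sqr_ge0 d) (sqr_ge0 (a - b)).
have := mulr_ge0 (sqr_ge0 d) (sqr_ge0 a).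
have := mulr_ge0 (sqr_ge0 d) (sqr_ge0 b).
have := mulr_ge0 (sqr_ge0 a) (sqr_ge0 b).
rewrite !expr2; lra.
Qed.

End kernels.

(** * The functional calculus *)

Section functional_calculus.
Variables (R : realType) (sigma : set R[i]) (X : completeNormedModType R[i]).
Variable psi : (sigma -> R[i]) -> {linear X -> X}.
Hypothesis psiP : AC_functional_calculus psi.
Implicit Types f g : sigma -> R[i].

Lemma calculusD f g x : AC f -> AC g -> psi (fun z => f z + g z) x = psi f x + psi g x.
Proof. by case: psiP => _ [pD _ _ _ _] ACf ACg; exact: pD. Qed.

Lemma calculusZ a f x : AC f -> psi (fun z => a * f z) x = a *: psi f x.
Proof. by case: psiP => _ [_ pZ _ _ _] ACf; exact: pZ. Qed.

Lemma calculusM f g x : AC f -> AC g -> psi (fun z => f z * g z) x = psi f (psi g x).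
Proof. by case: psiP => _ [_ _ pM _ _] ACf ACg; exact: pM. Qed.

Lemma calculus1 x : psi (fun=> 1) x = x.
Proof. by case: psiP => _ [_ _ _ p1 _]; exact: p1. Qed.

Lemma calculus_cst a x : psi (fun=> a) x = a *: x.
Proof.
rewrite (_ : (fun=> a) = (fun z : sigma => a * (fun=> 1) z)); last first.
  by apply/funext => z; rewrite mulr1.
by rewrite (calculusZ a _ (AC_cst 1)) calculus1.
Qed.

Lemma calculusB f g x : AC f -> AC g -> psi (fun z => f z - g z) x = psi f x - psi g x.
Proof.
move=> ACf ACg; under eq_fun do rewrite -mulN1r.
by rewrite (calculusD _ ACf (AC_scale _ ACg)) (calculusZ _ _ ACg) scaleN1r.
Qed.

Lemma calculus_bounded f : AC f -> bounded_op (psi f).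
Proof. by case: psiP => + _; exact. Qed.

Lemma calculus_sum n (F : nat -> sigma -> R[i]) x :
  (forall i, AC (F i)) ->
  psi (fun z => \sum_(i < n) F i z) x = \sum_(i < n) psi (F i) x.
Proof.
move=> ACF; elim: n => [|n IHn].
  rewrite big_ord0 (_ : (fun z => _) = fun=> 0); first by rewrite calculus_cst scale0r.
  by apply/funext => z; rewrite big_ord0.
under eq_fun do rewrite big_ord_recr /=.
by rewrite calculusD ?IHn ?big_ord_recr //; apply: AC_sum.
Qed.

Lemma calculus_shift f a x : AC f -> shift a (psi f) x = psi (fun z => a - f z) x.
Proof. by move=> ACf; rewrite (calculusB x (AC_cst a) ACf) calculus_cst. Qed.

Variable K : R.
Hypothesis sigma0 : sigma !=set0.
Hypothesis K0 : 0 <= K.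
Hypothesis sigmaK : forall z, sigma z -> rnorm z <= K.

(** All operator norms below are estimated through sup norms and Lipschitz constants. *)
Lemma calculus_lipschitz : exists2 M : R, 0 <= M &
  forall f b L, AC f -> 0 <= b -> 0 <= L -> bounded_lipschitz f b L ->
  forall x, rnorm (psi f x) <= M * (b + L) * rnorm x.
Proof.
case: psiP => _ [_ _ _ _ [M psiM]].
have k0 : 0 <= 1 + 4 * K by rewrite addr_ge0 // mulr_ge0.
exists (`|M| * (1 + 4 * K)); first by rewrite mulr_ge0.
move=> f b L ACf b0 L0 fbL; apply/opnorm_leP.
  by rewrite !mulr_ge0 // addr_ge0.
have bv := bounded_lipschitz_BV_norm sigmaK K0 L0 fbL.
have bvL : 0 <= b + 4 * K * L by rewrite addr_ge0 // !mulr_ge0.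
apply: le_trans (psiM f ACf) _.
have BV0 : (0%:E <= BV_norm f)%E.
  by apply: adde_ge0; [exact: sup_norm_ge0 | exact: var_ge0].
apply: (@le_trans _ _ (`|M|%:E * BV_norm f)%E).
  by rewrite lee_wpmul2r // lee_fin ler_norm.
apply: (@le_trans _ _ (`|M|%:E * (b + 4 * K * L)%:E)%E).
  by rewrite lee_wpmul2l // lee_fin.
rewrite -EFinM lee_fin -[leRHS]mulrA ler_wpM2l //.
have := mulr_ge0 K0 b0; have := mulr_ge0 K0 L0; lra.
Qed.

End functional_calculus.

(** * Rational functions of a rotated coordinate *)

Section rotated_coordinate.
Variables (R : realType) (sigma : set R[i]) (c : R[i]) (K : R).
Hypothesis K0 : 0 <= K.
Hypothesis sigmaK : forall z, sigma z -> rnorm z <= K.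
Hypothesis c1 : rnorm c = 1.

Definition zeta (z : sigma) : R[i] := c * val z.
Definition re_zeta (z : sigma) : R[i] := real_part c (val z).

Lemma zeta_lipschitz z w : rnorm (zeta z - zeta w) = rnorm (val z - val w).
Proof. by rewrite /zeta -mulrBr rnormM c1 mul1r. Qed.

Lemma rnorm_zeta z : rnorm (zeta z) <= K.
Proof. by rewrite /zeta rnormM c1 mul1r; apply: sigmaK; exact: set_valP. Qed.

Lemma AC_zeta : AC zeta.
Proof. exact: AC_scale (@AC_lambda _ _). Qed.

Lemma AC_zetaJ : AC (fun z => (zeta z)^*).
Proof.
rewrite (_ : (fun z => _) = (fun z => c^* * lambda_bar z)); last first.
  by apply/funext => z; rewrite /zeta rmorphM.
exact: AC_scale (@AC_lambda_bar _ _).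
Qed.

Lemma AC_re_zeta : AC re_zeta.
Proof.
rewrite (_ : re_zeta = fun z => 2^-1 * (zeta z + (zeta z)^*)).
  exact: AC_scale (AC_add AC_zeta AC_zetaJ).
by apply/funext => z; rewrite /re_zeta /real_part ReJ_add mulrC.
Qed.

Lemma AC_sub_zeta w : AC (fun z => w - zeta z).
Proof. exact: AC_sub (AC_cst w) AC_zeta. Qed.

Lemma AC_sub_zetaJ w : AC (fun z => (w - zeta z)^*).
Proof.
under eq_fun do rewrite rmorphB.
exact: AC_sub (AC_cst _) AC_zetaJ.
Qed.

Lemma AC_denom d w : AC (fun z => (denom d (w - zeta z))%:C).
Proof.
rewrite /denom; under eq_fun do rewrite rmorphD /= -mulrJ.
exact: AC_add (AC_mul (AC_sub_zeta w) (AC_sub_zetaJ w)) (AC_cst _).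
Qed.

Lemma sub_zeta_lipschitz w : bounded_lipschitz (fun z => w - zeta z) (rnorm w + K) 1.
Proof.
split=> [z|z z'].
  by rewrite (le_trans (ler_rnormD _ _)) // rnormN lerD2l rnorm_zeta.
rewrite mul1r -zeta_lipschitz rnormB.
by rewrite (_ : w - zeta z' - (w - zeta z) = zeta z - zeta z') //; ring.
Qed.

Lemma AC_denomV d w : 0 < d -> AC (fun z => (denom d (w - zeta z))%:C^-1).
Proof.
move=> d0; have wK0 : 0 <= rnorm w + K by rewrite addr_ge0 // rnorm_ge0.
have tJ : bounded_lipschitz (fun z => (w - zeta z)^*) (rnorm w + K) 1.
  have [tb tL] := sub_zeta_lipschitz w; split=> [z|z z'].
    by rewrite rnormJ.
  by rewrite -rmorphB rnormJ.
have d2 : bounded_lipschitz (fun=> (d ^+ 2)%:C : R[i]) (d ^+ 2) 0 (sigma := sigma).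
  split=> [z|z z']; first by rewrite rnormr ger0_norm ?sqr_ge0.
  by rewrite subrr rnorm0 mul0r.
have := bounded_lipschitzD (bounded_lipschitzM wK0 wK0 (sub_zeta_lipschitz w) tJ) d2.
under eq_fun do rewrite mulrJ -rmorphD /= -/(denom d (w - zeta _)).
move=> bl; apply: (AC_inv K0 sigmaK (m := d ^+ 2) _ _ _ bl).
- by rewrite exprn_gt0.
- by rewrite addr0 addr_ge0 // mulr_ge0.
- by move=> z; rewrite lerDr sqr_ge0.
- exact: AC_denom.
Qed.

Lemma AC_bump d w : 0 < d -> AC (fun z => bump d (w - zeta z)).
Proof. by move=> d0; apply: AC_scale; exact: AC_denomV. Qed.

Lemma AC_wave d w : 0 < d -> AC (fun z => wave d (w - zeta z)).
Proof.
by move=> d0; exact: AC_mul (AC_scale _ (AC_sub_zeta w)) (AC_denomV w d0).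
Qed.

Lemma bump_bounded_lipschitz d w : 0 < d ->
  bounded_lipschitz (fun z => bump d (w - zeta z)) 1 d^-1.
Proof.
move=> d0; split=> [z|z z']; first exact: rnorm_bump_le1.
apply: le_trans (bump_lipschitz _ _ d0) _; rewrite ler_wpM2l ?invr_ge0 ?(ltW d0) //.
by have := (sub_zeta_lipschitz w).2 z z'; rewrite mul1r.
Qed.

Lemma wave_bounded_lipschitz d w : 0 < d ->
  bounded_lipschitz (fun z => wave d (w - zeta z)) 1 d^-1.
Proof.
move=> d0; split=> [z|z z']; first exact: rnorm_wave_le1.
apply: le_trans (wave_lipschitz _ _ d0) _; rewrite ler_wpM2l ?invr_ge0 ?(ltW d0) //.
by have := (sub_zeta_lipschitz w).2 z z'; rewrite mul1r.
Qed.

End rotated_coordinate.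

(** * Spectra of T and of its real part *)

Section spectra.
Variables (R : realType) (sigma : set R[i]) (X : completeNormedModType R[i]).
Variable psi : (sigma -> R[i]) -> {linear X -> X}.
Hypothesis psiP : AC_functional_calculus psi.
Hypothesis sigma0 : sigma !=set0.
Variables (c : R[i]) (K : R).
Hypothesis K0 : 0 <= K.
Hypothesis sigmaK : forall z, sigma z -> rnorm z <= K.
Hypothesis c1 : rnorm c = 1.

Local Notation zeta := (@zeta R sigma c).
Local Notation re_zeta := (@re_zeta R sigma c).

Lemma re_zetaJ z : (re_zeta z)^* = re_zeta z.
Proof. by apply/eqP; rewrite eq_complex /= oppr0 !eqxx. Qed.

Lemma AC_sub_re_zeta a : AC (fun z => a - re_zeta z).
Proof. exact: AC_sub (AC_cst a) (@AC_re_zeta _ _ c). Qed.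

Lemma sub_re_zeta_lipschitz a :
  bounded_lipschitz (fun z => a - re_zeta z) (rnorm a + K) 1.
Proof.
split=> [z|z w].
  rewrite (le_trans (ler_rnormD _ _)) // rnormN lerD2l rnormr.
  by rewrite (le_trans (Re_le_rnorm _)) // rnorm_zeta.
rewrite mul1r -(zeta_lipschitz c1) rnormB.
rewrite (_ : a - re_zeta w - (a - re_zeta z) = re_zeta z - re_zeta w); last by ring.
by rewrite -rmorphB rnormr -raddfB Re_le_rnorm.
Qed.

Lemma resolvent_nonreal a : complex.Im a != 0 -> ~ spectrum (psi re_zeta) a.
Proof.
move=> a0; apply/notin_spectrum.
have ACs := AC_sub_re_zeta a; have ACr : AC re_zeta by exact: AC_re_zeta.
have low z : `|complex.Im a| <= rnorm (a - re_zeta z).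
  by apply: le_trans (Im_le_rnorm _); rewrite raddfB /= subr0.
have ACi : AC (fun z => (a - re_zeta z)^-1).
  apply: (AC_inv_complex K0 sigmaK _ _ ler01 low (sub_re_zeta_lipschitz a)) => //.
  - by rewrite normr_gt0.
  - by rewrite addr_ge0 ?rnorm_ge0.
  - under eq_fun do rewrite rmorphB /= re_zetaJ.
    exact: AC_sub_re_zeta.
have sne0 z : a - re_zeta z != 0.
  apply/eqP => /(congr1 (@rnorm _ _)); rewrite rnorm0 => e; have := low z.
  by rewrite e normr_le0 (negPf a0).
exists (psi (fun z => (a - re_zeta z)^-1)); split.
- exact: calculus_bounded.
- move=> x; rewrite /= calculus_shift // -calculusM //.
  under eq_fun do rewrite mulVf //.
  exact: calculus1.
- move=> x; rewrite /= calculus_shift // -calculusM //.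
  under eq_fun do rewrite mulfV //.
  exact: calculus1.
Qed.

(** With u = r - Re zeta and t = w - zeta, the function Q satisfies
    Q t = u^2 (1 - k^2). Since Re t = u, the error u k is d times the real part of
    the wave, so that u^2 k^2 is bounded by d^2 and 2d-Lipschitz. *)
Lemma resolvent_line (r s : R) : ~ spectrum (psi re_zeta) r%:C ->
  ~ spectrum (psi zeta) (r%:C + 'i%C * s%:C).
Proof.
move=> /notin_spectrum [C [/bounded_opP[a a0 Ca] CA AC_]]; apply/notin_spectrum.
set w := r%:C + 'i%C * s%:C.
have [M M0 psiM] := calculus_lipschitz psiP sigma0 K0 sigmaK.
(* Chosen so that the error a^2 M (3 d) below is at most 1/2. *)
pose D := 6 * a * a * M + 1.
have D1 : 1 <= D by rewrite lerDr !mulr_ge0.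
pose d := D^-1.
have d0 : 0 < d by rewrite invr_gt0 (lt_le_trans ltr01).
have dD : d * D = 1 by rewrite mulVf // gt_eqF // (lt_le_trans ltr01).
pose u z := r%:C - re_zeta z; pose t z := w - zeta z.
pose k z := bump d (t z).
have ACu : AC u by exact: AC_sub_re_zeta.
have ACt : AC t by exact: AC_sub_zeta.
have rew : complex.Re w = r by rewrite /w /=; ring.
have ACk : AC k := AC_bump K0 sigmaK c1 w d0.
pose Q z := u z * u z * (1 + k z) * ((t z)^* * (denom d (t z))%:C^-1).
have ACQ : AC Q := AC_mul (AC_mul (AC_mul ACu ACu) (AC_add (AC_cst 1) ACk))
  (AC_mul (AC_sub_zetaJ c w) (AC_denomV K0 sigmaK c1 w d0)).
pose G z := u z * k z * (u z * k z).
have ACG : AC G by exact: AC_mul (AC_mul ACu ACk) (AC_mul ACu ACk).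
have Qt z : Q z * t z = u z * u z - G z.
  have n0 := denomC_neq0 (t z) d0; set n := (denom d (t z))%:C in n0 *.
  have tJ : t z * (t z)^* = n - (d ^+ 2)%:C.
    by rewrite mulrJ /n /denom rmorphD /=; ring.
  rewrite /Q /G /k /bump -/n.
  transitivity (u z * u z * (1 + (d ^+ 2)%:C / n) * (t z * (t z)^*) / n); first by ring.
  by rewrite tJ; field.
have uE z : u z = (complex.Re (t z))%:C.
  rewrite /u /re_zeta /real_part -rmorphB; congr (_%:C).
  by rewrite /t raddfB; congr (_ - _); rewrite -rew.
have ukE z : u z * k z = (d * complex.Re (wave d (t z)))%:C.
  have -> : wave d (t z) = (d / denom d (t z))%:C * t z.
    by rewrite /wave fmorph_div mulrAC.
  by rewrite uE /k /bump Re_mul /= mul0r subr0 -fmorphV -!rmorphM; congr (_%:C); ring.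
have ukbL : bounded_lipschitz (fun z => u z * k z) d 1.
  have [wb wL] := wave_bounded_lipschitz sigmaK c1 w d0.
  split=> [z|z z']; rewrite !ukE.
    rewrite rnormr normrM (ger0_norm (ltW d0)) ler_piMr ?(ltW d0) //.
    exact: le_trans (Re_le_rnorm _) (wb z).
  rewrite -rmorphB -mulrBr -raddfB rnormr normrM (ger0_norm (ltW d0)) mul1r.
  apply: le_trans (ler_wpM2l (ltW d0) (le_trans (Re_le_rnorm _) (wL z z'))) _.
  by rewrite mulrA mulfV ?mul1r // gt_eqF.
have GbL := bounded_lipschitzM (ltW d0) (ltW d0) ukbL ukbL.
have dle1 : d <= 1 by rewrite invf_le1 // (lt_le_trans ltr01).
have psiG x : rnorm (psi G x) <= M * (3 * d) * rnorm x.
  apply: le_trans (psiM _ _ _ ACG _ _ GbL x) _;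
    rewrite ?mulr1 ?addr_ge0 ?mulr_ge0 ?(ltW d0) //.
  rewrite ler_wpM2r ?rnorm_ge0 // ler_wpM2l //.
  by have := mulr_ge0 (ltW d0) (_ : 0 <= 1 - d); rewrite subr_ge0 => /(_ dle1); lra.
have T_bounded : bounded_op (shift w (psi zeta)).
  apply: bounded_shift; apply: (calculus_bounded psiP); exact: AC_zeta.
have [b b0 Qb] := (bounded_opP _).1 (calculus_bounded psiP ACQ).
have small : a * (a * (M * (3 * d))) <= 2^-1.
  have : d * (6 * a * a * M + 1) = 1 by [].
  lra.
have uSE x : psi u x = shift r%:C (psi re_zeta) x by rewrite calculus_shift //;
  exact: AC_re_zeta.
have Cu x : C (psi u x) = x by rewrite uSE; exact: CA.
have uC x : psi u (C x) = x by rewrite uSE; exact: AC_.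
have tE x : shift w (psi zeta) x = psi t x by rewrite calculus_shift //; exact: AC_zeta.
have QE x : psi (fun z => Q z * t z) x = psi u (psi u x) - psi G x.
  rewrite -calculusM // -calculusB //; last exact: AC_mul.
  by congr (psi _ x); apply/funext.
apply: (@approx_invertible _ _ _ (fun x => C (C (psi Q x)))
          (fun x => psi Q (C (C x))) (a * (a * b))) => //.
- move=> x; rewrite -!mulrA; apply: le_trans (Ca _) _; rewrite ler_wpM2l //.
  by apply: le_trans (Ca _) _; rewrite ler_wpM2l.
- move=> x; apply: le_trans (Qb _) _.
  have -> : a * (a * b) * rnorm x = b * (a * (a * rnorm x)) by ring.
  rewrite ler_wpM2l //; apply: le_trans (Ca _) _.
  by rewrite ler_wpM2l.
- move=> x; rewrite /= tE -calculusM // QE (linearB C) (linearB C) /= !Cu.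
  rewrite opprB addrC subrK; apply: le_trans (Ca _) _.
  apply: (@le_trans _ _ (a * (a * (M * (3 * d) * rnorm x)))).
    by rewrite ler_wpM2l //; apply: le_trans (Ca _) _; rewrite ler_wpM2l.
  by rewrite !mulrA ler_wpM2r ?rnorm_ge0 // -!mulrA.
- move=> x; rewrite /= tE -calculusM //; under eq_fun do rewrite mulrC.
  rewrite QE !uC opprB addrC subrK; apply: le_trans (psiG _) _.
  apply: (@le_trans _ _ (M * (3 * d) * (a * (a * rnorm x)))).
    apply: ler_wpM2l; first by rewrite !mulr_ge0 // ltW.
    by apply: le_trans (Ca _) _; rewrite ler_wpM2l.
  have -> : M * (3 * d) * (a * (a * rnorm x)) = a * (a * (M * (3 * d))) * rnorm x by ring.
  by rewrite ler_wpM2r ?rnorm_ge0.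
Qed.

Lemma iter_lower_bound (T : {linear X -> X}) (a : R) n x : 0 <= a ->
  (forall y, rnorm y <= a * rnorm (T y)) ->
  rnorm x <= a ^+ n * rnorm (iter n T x).
Proof.
move=> a0 aT; elim: n => [|n IHn]; first by rewrite mul1r.
apply: le_trans IHn _; rewrite exprSr -mulrA ler_wpM2l ?exprn_ge0 //.
Qed.

Lemma calculusX (f : sigma -> R[i]) n x : AC f ->
  psi (fun z => f z ^+ n) x = iter n (psi f) x.
Proof.
move=> ACf; elim: n => [|n IHn] /=; first exact: (calculus1 psiP).
under eq_fun do rewrite exprS.
by rewrite (calculusM psiP _ ACf (AC_exp n ACf)) IHn.
Qed.

(** The exponent 9 beats the losses: the sum over the grid costs 1/d, the Lipschitz
    constant of g^9 costs 1/d, and the Lipschitz norm of 1/F costs d^(-6); one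
    factor d is left. *)
Lemma resolvent_projection (r : R) :
  (forall s : R, ~ spectrum (psi zeta) (r%:C + 'i%C * s%:C)) ->
  ~ spectrum (psi re_zeta) r%:C.
Proof.
move=> rT; apply/notin_spectrum.
have [M M0 psiM] := calculus_lipschitz psiP sigma0 K0 sigmaK.
pose N := (Num.truncn K).+1.
have KN : K <= N%:R by apply/ltW; exact: truncnS_gt.
have N1 : 1 <= N%:R :> R by rewrite (ler_nat _ 1%N).
have N0 : 0 <= N%:R :> R := le_trans ler01 N1.
have [a a0 low] := uniform_lower_bound N0 rT.
pose u z := r%:C - re_zeta z; have ACu : AC u by exact: AC_sub_re_zeta.
pose U0 := `|r| + K; have U00 : 0 <= U0 by rewrite addr_ge0.
(* Within distance d of the line some grid point w_j has |t_j|^2 <= 2 d^2,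
   so that k_j >= 1/3. *)
pose c0 : R := 3^-1 ^+ 9; have c00 : 0 < c0 by rewrite exprn_gt0.
pose C1 := 2 * U0 + 27 * N%:R; have C10 : 0 <= C1 by rewrite addr_ge0 // mulr_ge0.
pose E1 := M * (c0^-1 + C1 / c0 ^+ 2).
pose E2 := 30 * N%:R * (a ^+ 9 * M).
have E10 : 0 <= E1.
  rewrite mulr_ge0 // addr_ge0 ?invr_ge0 ?(ltW c00) // divr_ge0 //.
  by rewrite exprn_ge0 // ltW.
have E20 : 0 <= E2 by rewrite !mulr_ge0 // exprn_ge0.
(* E1 n^6 bounds psi(1/F) and E2 n^-7 bounds psi(S). *)
pose n := (Num.truncn (2 * E1 * E2)).+1.
have nE : 2 * E1 * E2 <= n%:R by apply/ltW; exact: truncnS_gt.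
have n1 : 1 <= n%:R :> R by rewrite (ler_nat _ 1%N).
have n0 : 0 < n%:R :> R := lt_le_trans ltr01 n1.
pose d : R := n%:R^-1; have d0 : 0 < d by rewrite invr_gt0.
have dV : d^-1 = n%:R by rewrite invrK.
have d1 : d <= 1 by rewrite invf_le1.
pose v (j : nat) : R := - N%:R + j%:R * d.
pose w j : R[i] := r%:C + 'i%C * (v j)%:C.
pose J := (2 * N * n).+1.
have JN : J%:R <= 3 * N%:R * n%:R :> R.
  rewrite /J -natr1 !natrM; have := ler_pM ler01 ler01 N1 n1; lra.
pose t j z := w j - zeta z.
pose h j z := bump d (t j z) ^+ 9.
pose S z := \sum_(j < J) h j z.
have ACh j : AC (h j) := AC_exp 9 (AC_bump K0 sigmaK c1 (w j) d0).
have ACS : AC S := AC_sum (fun j _ => ACh j).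
pose g j z := wave d (t j z) ^+ 9.
have gbL j : bounded_lipschitz (g j) 1 (9 * n%:R).
  rewrite -dV; apply: bounded_lipschitzX1; first by rewrite invr_ge0 ltW.
  exact: (wave_bounded_lipschitz sigmaK c1 (w j) d0).
have hbL j : bounded_lipschitz (h j) 1 (9 * n%:R).
  rewrite -dV; apply: bounded_lipschitzX1; first by rewrite invr_ge0 ltW.
  exact: (bump_bounded_lipschitz sigmaK c1 (w j) d0).
have ACg j : AC (g j) := AC_exp 9 (AC_wave K0 sigmaK c1 (w j) d0).
have ACt j : AC (t j) by exact: AC_sub_zeta.
have th j z : t j z ^+ 9 * h j z = (d ^+ 9)%:C * g j z.
  rewrite /h /g -exprMn rmorphXn -exprMn; congr (_ ^+ 9).
  by rewrite /bump /wave rmorphXn /=; ring.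
have psih j x : (j < J)%N ->
    rnorm (psi (h j) x) <= a ^+ 9 * (d ^+ 9 * (M * (1 + 9 * n%:R) * rnorm x)).
  move=> jJ; have vN : - N%:R <= v j <= N%:R.
    rewrite /v lerDl mulr_ge0 // ?(ltW d0) //=.
    rewrite -lerBrDl opprK ler_pdivrMr //.
    by move: jJ; rewrite ltnS => jJ; rewrite -natrD -natrM ler_nat addnn -mul2n.
  have lowt y : rnorm y <= a * rnorm (psi (t j) y).
    by apply: le_trans (low _ vN y) _; rewrite calculus_shift //; exact: AC_zeta.
  apply: le_trans (iter_lower_bound 9 (psi (h j) x) a0 lowt) _.
  rewrite ler_wpM2l ?exprn_ge0 // -calculusX // -(calculusM psiP _ (AC_exp 9 (ACt j)) (ACh j)).
  under eq_fun do rewrite th.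
  rewrite (calculusZ psiP _ _ (ACg j)) rnormZ rnormr ger0_norm ?exprn_ge0 ?(ltW d0) //.
  rewrite ler_wpM2l ?exprn_ge0 ?(ltW d0) //.
  by apply: psiM => //; rewrite mulr_ge0.
have psiS x : rnorm (psi S x) <= J%:R * (a ^+ 9 * (d ^+ 9 * (M * (1 + 9 * n%:R) * rnorm x))).
  rewrite (calculus_sum psiP J x ACh); apply: le_trans (rnorm_sum _ _) _.
  apply: (@le_trans _ _ (\sum_(j < J) (a ^+ 9 * (d ^+ 9 * (M * (1 + 9 * n%:R) * rnorm x))))).
    by apply: ler_sum => j _; exact: psih.
  by rewrite sumr_const card_ord -[leLHS]mulr_natl.
have psiS' x : rnorm (psi S x) * n%:R ^+ 7 <= E2 * rnorm x.
  apply: le_trans (ler_wpM2r (exprn_ge0 7 (ltW n0)) (psiS x)) _.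
  have dn : d ^+ 9 * n%:R ^+ 9 = 1 by rewrite -exprMn mulVf ?expr1n // gt_eqF.
  have -> : E2 * rnorm x = 3 * N%:R * n%:R *
      (a ^+ 9 * (d ^+ 9 * (M * (10 * n%:R) * rnorm x))) * n%:R ^+ 7.
    by rewrite -[LHS]mulr1 -[X in _ * X = _]dn /E2; ring.
  rewrite ler_wpM2r ?exprn_ge0 ?(ltW n0) //; apply: ler_pM => //.
    by rewrite !mulr_ge0 ?exprn_ge0 ?rnorm_ge0 ?addr_ge0 ?mulr_ge0 ?(ltW d0).
  rewrite ler_wpM2l ?exprn_ge0 // ler_wpM2l ?exprn_ge0 ?(ltW d0) //.
  by rewrite ler_wpM2r ?rnorm_ge0 // ler_wpM2l //; lra.
pose F z : R := (r - complex.Re (zeta z)) ^+ 2 + \sum_(j < J) (d ^+ 2 / denom d (t j z)) ^+ 9.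
have FE z : (F z)%:C = u z * u z + S z.
  rewrite /F rmorphD /= expr2 rmorphM /= /S rmorph_sum /=; congr (_ * _ + _).
  - by rewrite /u /re_zeta /real_part rmorphB.
  - by rewrite /u /re_zeta /real_part rmorphB.
  by apply: eq_bigr => j _; rewrite rmorphXn /= fmorph_div.
have Flow z : c0 * d ^+ 2 <= F z.
  have d21 : d ^+ 2 <= 1 by rewrite expr_le1 // ltW.
  have c01 : c0 <= 1 by rewrite expr_le1 // invf_le1 // (ler_nat _ 1%N).
  have term0 j : 0 <= (d ^+ 2 / denom d (t j z)) ^+ 9.
    by rewrite exprn_ge0 // divr_ge0 ?sqr_ge0 // ltW // denom_gt0.
  (* Near the line the sum S is large, away from it u^2 is. *)
  have [ud|du] := leP `|r - complex.Re (zeta z)| d; last first.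
    apply: (@le_trans _ _ (d ^+ 2)); first by rewrite ler_piMl // sqr_ge0.
    rewrite /F -[leLHS]addr0 lerD ?sumr_ge0 // -[leRHS]real_normK ?num_real //.
    by rewrite lerXn2r ?nnegrE ?(ltW d0) // ltW.
  pose q := complex.Im (zeta z).
  have qN : - N%:R <= q <= N%:R.
    rewrite -ler_norml (le_trans (Im_le_rnorm _)) // (le_trans _ KN) //.
    exact: rnorm_zeta.
  have q0 : 0 <= (q + N%:R) * n%:R by rewrite mulr_ge0 ?(ltW n0) //; lra.
  pose j := Num.truncn ((q + N%:R) * n%:R).
  have /andP[j1 j2] := truncn_itv q0; rewrite -/j in j1 j2.
  have jJ : (j < J)%N.
    rewrite ltnS -(ler_nat R) natrM natrM; apply: le_trans j1 _.
    by rewrite ler_wpM2r ?(ltW n0) //; lra.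
  have vq : `|v j - q| <= d.
    have e1 : (q + N%:R) * n%:R * d = q + N%:R by rewrite -mulrA mulfV ?mulr1 // gt_eqF.
    have e2 : j.+1%:R * d = j%:R * d + d by rewrite -natr1 mulrDl mul1r.
    have := ler_wpM2r (ltW d0) j1; have := ler_wpM2r (ltW d0) (ltW j2).
    rewrite e1 e2 ler_norml /v => h1 h2.
    by apply/andP; split; lra.
  have : 3^-1 <= d ^+ 2 / denom d (t j z).
    rewrite ler_pdivlMr ?denom_gt0 // /denom rnorm_sqr.
    have -> : complex.Re (t j z) = r - complex.Re (zeta z).
      by rewrite /t raddfB; congr (_ - _); rewrite /w /=; ring.
    have -> : complex.Im (t j z) = v j - q.
      by rewrite /t raddfB; congr (_ - _); rewrite /w /=; ring.
    rewrite -(real_normK (num_real (r - _))) -(real_normK (num_real (v j - q))).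
    have : `|r - complex.Re (zeta z)| ^+ 2 <= d ^+ 2 by rewrite lerXn2r ?nnegrE ?(ltW d0).
    have : `|v j - q| ^+ 2 <= d ^+ 2 by rewrite lerXn2r ?nnegrE ?(ltW d0).
    lra.
  move=> /(lerXn2r 9 _ _); rewrite !nnegrE invr_ge0 ler0n => /(_ isT) h9.
  apply: (@le_trans _ _ c0); first by rewrite ler_piMr // ltW.
  rewrite /F (bigD1 (Ordinal jJ)) //=.
  apply: le_trans (h9 _) _; first by rewrite divr_ge0 ?sqr_ge0 // ltW // denom_gt0.
  by rewrite addrCA lerDl addr_ge0 ?sqr_ge0 // sumr_ge0.
have FbL : bounded_lipschitz (fun z => (F z)%:C) (U0 * U0 + J%:R) (C1 * n%:R ^+ 2).
  have ubL : bounded_lipschitz u U0 1.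
    by have := sub_re_zeta_lipschitz r%:C; rewrite rnormr.
  have := bounded_lipschitzD (bounded_lipschitzM U00 U00 ubL ubL) (bounded_lipschitz_sum J hbL).
  under eq_fun do rewrite -/(S _) -FE.
  apply: bounded_lipschitz_weaken; first by rewrite mulr1.
  have nn : 1 <= n%:R ^+ 2 :> R by rewrite exprn_ege1.
  have h1 : J%:R * (9 * n%:R) <= 27 * N%:R * n%:R ^+ 2 :> R.
    have -> : 27 * N%:R * n%:R ^+ 2 = 3 * N%:R * n%:R * (9 * n%:R) :> R by ring.
    by rewrite ler_wpM2r // mulr_ge0 // ltW.
  have := ler_wpM2l U00 nn; rewrite /C1; lra.
have ACF : AC (fun z => (F z)%:C).
  by under eq_fun do rewrite FE; exact: AC_add (AC_mul ACu ACu) ACS.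
have c0d : 0 < c0 * d ^+ 2 by rewrite mulr_gt0 // exprn_gt0.
have C1n : 0 <= C1 * n%:R ^+ 2 by rewrite mulr_ge0 // exprn_ge0.
have ACFV : AC (fun z => (F z)%:C^-1) := AC_inv K0 sigmaK c0d C1n Flow FbL ACF.
have psiFV x : rnorm (psi (fun z => (F z)%:C^-1) x) <= E1 * n%:R ^+ 6 * rnorm x.
  have Fn z : c0 * d ^+ 2 <= rnorm (F z)%:C.
    by rewrite rnormr (le_trans (Flow z)) // ler_norm.
  have m0 : 0 <= (c0 * d ^+ 2)^-1 by rewrite invr_ge0 ltW.
  have L0 : 0 <= C1 * n%:R ^+ 2 / (c0 * d ^+ 2) ^+ 2 by rewrite divr_ge0 // sqr_ge0.
  apply: le_trans (psiM _ _ _ ACFV m0 L0 (bounded_lipschitzV c0d C1n Fn FbL) x) _.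
  rewrite ler_wpM2r ?rnorm_ge0 // /E1 -[leRHS]mulrA ler_wpM2l //.
  have n0' : n%:R != 0 :> R by rewrite gt_eqF.
  have -> : (c0 * d ^+ 2)^-1 = c0^-1 * n%:R ^+ 2.
    by rewrite /d; field; rewrite n0' gt_eqF.
  have -> : C1 * n%:R ^+ 2 / (c0 * d ^+ 2) ^+ 2 = C1 / c0 ^+ 2 * n%:R ^+ 6.
    by rewrite /d; field; rewrite n0' gt_eqF.
  rewrite [leRHS]mulrDl lerD2r ler_wpM2l ?invr_ge0 ?(ltW c00) //.
  by rewrite ler_weXn2l.
pose V z := u z * (F z)%:C^-1; have ACV : AC V := AC_mul ACu ACFV.
have Vu x : x - psi (fun z => V z * u z) x = psi (fun z => (F z)%:C^-1) (psi S x).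
  rewrite -{1}[x](calculus1 psiP) -(calculusB psiP) //; last 2 first.
    exact: AC_cst.
    exact: AC_mul.
  rewrite -(calculusM psiP) //; congr (psi _ x); apply/funext => z.
  have F0 : ((F z)%:C : R[i]) != 0.
    by rewrite fmorph_eq0 gt_eqF // (lt_le_trans c0d).
  have -> : S z = (F z)%:C - u z * u z by rewrite FE; ring.
  by rewrite /V; field.
have half x : rnorm (psi (fun z => (F z)%:C^-1) (psi S x)) <= 2^-1 * rnorm x.
  apply: le_trans (psiFV _) _; rewrite -(ler_pM2l n0).
  have -> : n%:R * (E1 * n%:R ^+ 6 * rnorm (psi S x)) = E1 * (rnorm (psi S x) * n%:R ^+ 7) by ring.
  apply: le_trans (ler_wpM2l E10 (psiS' x)) _.
  have := ler_wpM2r (rnorm_ge0 x) nE; lra.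
have [b b0 Vb] := (bounded_opP _).1 (calculus_bounded psiP ACV).
have uE x : shift r%:C (psi re_zeta) x = psi u x.
  by rewrite calculus_shift //; exact: AC_re_zeta.
apply: (@approx_invertible _ _ _ (psi V) (psi V) b) => //.
- by apply: bounded_shift; apply: (calculus_bounded psiP); exact: AC_re_zeta.
- by move=> x; rewrite /= uE -(calculusM psiP) // Vu.
- move=> x; rewrite /= uE -(calculusM psiP) //; under eq_fun do rewrite mulrC.
  by rewrite Vu.
Qed.

End spectra.

(** * The decomposition *)

Section spectrum_scale.
Variables (R : realType) (X : completeNormedModType R[i]).
Implicit Types T : {linear X -> X}.

Lemma spectrum_scale T T' (a b z : R[i]) : (forall x, T' x = a *: T x) ->
  b * a = 1 -> spectrum T z -> spectrum T' (a * z).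
Proof.
move=> T'E ba1; apply: contra_not => -[U [/bounded_opP[m m0 Um] UT TU]].
have aU x : a *: (z *: x - T x) = (a * z) *: x - T' x.
  by rewrite T'E scalerBr scalerA.
exists (a \*: U); split=> [|x|x] /=.
- apply/bounded_opP; exists (rnorm a * m); first by rewrite mulr_ge0 ?rnorm_ge0.
  by move=> x; rewrite rnormZ -mulrA ler_wpM2l ?rnorm_ge0.
- by rewrite -linearZ /= aU UT.
- by rewrite -[RHS]TU T'E (linearZ_LR T) /= scalerA [z * a]mulrC.
Qed.

End spectrum_scale.

Section real_parts.
Variables (R : realType) (sigma : set R[i]) (X : completeNormedModType R[i]).
Variable psi : (sigma -> R[i]) -> {linear X -> X}.
Hypothesis psiP : AC_functional_calculus psi.
Hypothesis sigma0 : sigma !=set0.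
Variables (c : R[i]) (K : R).
Hypothesis K0 : 0 <= K.
Hypothesis sigmaK : forall z, sigma z -> rnorm z <= K.
Hypothesis c1 : rnorm c = 1.

Lemma spectrum_re_zeta : spectrum (psi (re_zeta c)) =
  [set (complex.Re z)%:C | z in spectrum (psi (zeta c))].
Proof.
apply/seteqP; split=> [z Az|_ [w Tw <-]]; last first.
  apply: contrapT => /(resolvent_line psiP sigma0 K0 sigmaK c1 (s := complex.Im w)).
  by rewrite -complexE.
have zr : complex.Im z = 0.
  by apply/eqP; apply: contrapT => /negP /(resolvent_nonreal psiP K0 sigmaK c1).
have zE : z = (complex.Re z)%:C.
  by apply/eqP; rewrite eq_complex /= zr !eqxx.
apply: contrapT => nz.
have := @resolvent_projection _ _ _ _ psiP sigma0 c K K0 sigmaK c1 (complex.Re z).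
apply=> [s Ts|].
  apply: nz; exists ((complex.Re z)%:C + 'i%C * s%:C) => //.
  by rewrite [in RHS]zE; congr (_%:C); rewrite /=; ring.
by rewrite -zE.
Qed.

(** The calculus on [-K, K] is f |-> psi (f o Re zeta); composition is multiplicative
    and decreases the BV norm. *)
Lemma well_bounded_re_zeta : well_bounded (psi (re_zeta c)).
Proof.
exists (- K), K; split; first by rewrite (le_trans _ K0) // oppr_le0.
set J : set R[i] := [set _ | _ in _].
have piJ (z : sigma) : J (real_part c (val z)).
  exists (complex.Re (c * val z)) => //; rewrite /= in_itv /= -ler_norml.
  by rewrite (le_trans (Re_le_rnorm _)) //; exact: rnorm_zeta.
pose pi (z : sigma) : J := exist (fun w => w \in J) _ (mem_set (piJ z)).
have piE z : val (pi z) = real_part c (val z) by [].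
have JK z : J z -> rnorm z <= K.
  by move=> [x + <-]; rewrite /= in_itv /= -ler_norml rnormr.
have JR z : J z -> complex.Im z = 0 by move=> [x _ <-].
have ACpi f : AC f -> AC (f \o pi).
  by move=> ACf; exact: (AC_comp c1 piE sigma0 JK JR ACf).
have BVpi f : (BV_norm (f \o pi) <= BV_norm f)%E by exact: (BV_norm_comp c1 piE).
exists (fun f => psi (f \o pi)); last by move=> x; congr (psi _ x).
case: psiP => psib [pD pZ pM p1 [M psiM]]; split.
  by move=> f /ACpi; exact: psib.
split.
- by move=> f g /ACpi ACf /ACpi ACg x; exact: pD.
- by move=> a f /ACpi ACf x; exact: pZ.
- by move=> f g /ACpi ACf /ACpi ACg x; exact: pM.
- exact: p1.
exists `|M| => f ACf; apply: le_trans (psiM _ (ACpi _ ACf)) _.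
have BV0 : (0%:E <= BV_norm (f \o pi))%E.
  by apply: adde_ge0; [exact: sup_norm_ge0 | exact: var_ge0].
apply: (@le_trans _ _ (`|M|%:E * BV_norm (f \o pi))%E).
  by rewrite lee_wpmul2r // lee_fin ler_norm.
by rewrite lee_wpmul2l // lee_fin.
Qed.

End real_parts.

Theorem theorem5p5 (R : realType) (sigma : set R[i])
  (sigma_neq0 : sigma !=set0) (sigma_compact : compact sigma)
  (X : completeNormedModType R[i]) (T : {linear X -> X})
  (T_bounded : bounded_op T) (T_AC : AC_operator sigma T) :
  exists A B : {linear X -> X},
    [/\ bounded_op A /\ bounded_op B,
        forall x, T x = A x + 'i%C *: B x,
        forall x, A (B x) = B (A x),
        well_bounded A /\ well_bounded B &
        spectrum A = [set (complex.Re z)%:C | z in spectrum T] /\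
        spectrum B = [set (complex.Im z)%:C | z in spectrum T]].
Proof.
have [psi psiP psiT] := T_AC.
have [K K0 sigmaK] := compact_rnorm_bounded sigma_compact.
have c1 : rnorm (1 : R[i]) = 1 by rewrite (rnormr 1) normr1.
have ci : rnorm (- 'i%C : R[i]) = 1 by rewrite rnormN rnorm_i.
have ACA := @AC_re_zeta R sigma 1; have ACB := @AC_re_zeta R sigma (- 'i%C).
exists (psi (re_zeta 1)), (psi (re_zeta (- 'i%C))); split.
- by split; exact: calculus_bounded.
- move=> x; rewrite -psiT -(calculusZ psiP) // -(calculusD psiP) //;
    last exact: AC_scale.
  congr (psi _ x); apply/funext => z; rewrite /lambda [LHS]complexE.
  rewrite /re_zeta /real_part mul1r; congr (_ + _ * _%:C).
  by case: (val z) => p q /=; ring.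
- move=> x; rewrite -!(calculusM psiP) //; congr (psi _ x).
  by apply/funext => z; rewrite mulrC.
- by split; apply: (well_bounded_re_zeta psiP sigma_neq0 K0 sigmaK).
have T1 x : psi (zeta 1) x = 1 *: T x.
  by rewrite scale1r -psiT; congr (psi _ x); apply/funext => z; rewrite /zeta mul1r.
have Ti x : psi (zeta (- 'i%C)) x = - 'i%C *: T x.
  by rewrite -psiT -(calculusZ psiP) //; exact: AC_lambda.
have iiN : 'i%C * - 'i%C = 1 :> R[i].
  by apply/eqP; rewrite eq_complex /=; apply/andP; split; apply/eqP; ring.
have NiI : - 'i%C * 'i%C = 1 :> R[i] by rewrite mulrC.
rewrite (spectrum_re_zeta psiP sigma_neq0 K0 sigmaK c1).
rewrite (spectrum_re_zeta psiP sigma_neq0 K0 sigmaK ci).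
split; apply/seteqP; split => _ [z Tz <-].
- exists z => //; rewrite -[z]mul1r; apply: (spectrum_scale _ (mul1r 1) Tz) => x.
  by rewrite T1 !scale1r.
- exists z => //; rewrite -[z]mul1r; exact: spectrum_scale T1 (mul1r 1) Tz.
- exists ('i%C * z).
    apply: (spectrum_scale _ NiI Tz) => x.
    by rewrite Ti scalerA iiN scale1r.
  by congr (_%:C); case: z {Tz} => p q /=; ring.
- exists (- 'i%C * z); first exact: spectrum_scale Ti iiN Tz.
  by congr (_%:C); case: z {Tz} => p q /=; ring.
Qed.
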